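(* Consider the discrete-time filtering model, the numerical maps $\Psi_n^N$, the mean-field EnKF measures $\bar\mu_n$, the EnKF estimators $\mu_n^{\boldsymbol\ell}[\varphi]$, the four-coupled estimators $\boldsymbol\Delta\mu_n^{\boldsymbol\ell}[\varphi]$, admissible QoIs, and the MIEnKF estimator $\mu_n^{MI}[\varphi]$ defined in the context, with $N_{\ell_1}=N_0\,2^{\ell_1}$ and $P_{\ell_2}=P_0\,2^{\ell_2}$ for fixed positive integers $N_0,P_0$. Assume: (1) For any $n\in\mathbb N_0$ and any $p\ge 2$ there exists a constant $c_p>0$ such that for all $u,v\in\bigcap_{q\ge2}L^q_n(\Omega,\mathbb R^d)$ and all $N\ge1$, $$\|\Psi_n^N(u)\|_p\le c_p(1+\|u\|_p),\qquad \|\Psi_n^N(u)-\Psi_n^N(v)\|_p\le c_p\|u-v\|_p .$$ (2) For any admissible QoI $\varphi$ and any $n\ge0$, with implied constants not depending on $\boldsymbol\ell=(\ell_1,\ell_2)\in\mathbb N_0^2$, $$\big|\mathbb E[\boldsymbol\Delta\mu_n^{\boldsymbol\ell}[\varphi]]\big|\lesssim N_{\ell_1}^{-1}P_{\ell_2}^{-1},\qquad \mathbb V[\boldsymbol\Delta\mu_n^{\boldsymbol\ell}[\varphi]]\lesssim N_{\ell_1}^{-2}P_{\ell_2}^{-2},\qquad \mathrm{Cost}(\boldsymbol\Delta\mu_n^{\boldsymbol\ell}[\varphi])\eqsim N_{\ell_1}P_{\ell_2}.$$ For any $\epsilon\in(0,1)$ consider the MIEnKF method with triangular index set $\mathcal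 I=\{\boldsymbol\ell\in\mathbb N_0^2 \mid \ell_1+\ell_2\le L\}$, where $$L=\max\Big(\big\lceil \log_2\epsilon^{-1}+\log_2\log_2\epsilon^{-1}\big\rceil-L_0,\;1\Big)\quad\text{for some fixed } L_0\in\mathbb N_0,$$ and numbers of samples $M_{\boldsymbol\ell}\in\mathbb N$ satisfying $$M_{\boldsymbol\ell}\eqsim\epsilon^{-2}N_{\ell_1}^{-3/2}P_{\ell_2}^{-3/2},\qquad \boldsymbol\ell\in\mathcal I,$$ with implied constants independent of $\epsilon$ and $\boldsymbol\ell$. Then for any admissible QoI $\varphi$ and any $n\ge0$, $$\mathbb E\big[(\mu_n^{MI}[\varphi]-\bar\mu_n[\varphi])^2\big]\lesssim\epsilon^2,$$ and the computational cost of the MIEnKF estimator satisfies $$\mathrm{Cost}(\mu_n^{MI}[\varphi])\eqsim\epsilon^{-2},$$ where the implied constants do not depend on $\epsilon$.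
   Context: **Notation.** $\mathbb N=\{1,2,\dots\}$, $\mathbb N_0=\mathbb N\cup\{0\}$. For nonnegative quantities, $f\lesssim g$ means that there is a constant $C>0$ with $f\le Cg$ for all values of the argument; $f\eqsim g$ means $f\lesssim g$ and $g\lesssim f$. $\mathbb E$ and $\mathbb V$ denote expectation and variance; $|\cdot|$ is the Euclidean norm; $\|u\|_p=(\mathbb E|u|^p)^{1/p}$. $(\Omega,\mathcal F,\mathbb P;\{\mathcal F_t\}_{t\ge0})$ is a complete filtered probability space, and $L_t^p(\Omega,\mathbb R^k)$ is the space of $\mathcal F_t$-measurable $u:\Omega\to\mathbb R^k$ with $\mathbb E|u|^p<\infty$. Write $\boldsymbol\ell=(\ell_1,\ell_2)\in\mathbb N_0^2$, $\boldsymbol e_1=(1,0)$, $\boldsymbol e_2=(0,1)$, $\boldsymbol 1=(1,1)$. EnKF stands for ensemble Kalman filter, MIEnKF for multi-index EnKF, QoI for quantity of interest. **Filtering model.** $u_0\in\bigcap_{p\ge2}L^p_0(\Omega,\mathbb R^d)$; $u_{n+1}=\Psi_n(u_n,\omega)$ with random maps $\Psi_n:\mathbb R^d\times\Omega\to\mathbb R^d$; observations $y_{n+1}=Hu_{n+1}+\eta_{n+1}$ with $H\in\mathbb R^{m\times d}$ and $\eta_k$ i.i.d. $N(0,\Gamma)$, independent of $\{u_k\}$, where $\Gamma\in\mathbb R^{m\times m}$ is symmetric positive definite. The filters below are computed for a given (fixed) observation sequence $y_1,y_2,\dots\in\mathbb R^m$. $\Psi_n^N:\mathbb R^d\times\Omega\to\mathbb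 R^d$ denotes a numerical discretization of $\Psi_n$ using $N\ge1$ uniform timesteps over each observation-time interval; the $\omega$-argument (driving noise) is often suppressed. **Mean-field EnKF measure $\bar\mu_n$.** This is the large-ensemble and fine-discretization limit of EnKF. Let $\hat{\bar v}_0$ have the distribution of $u_0$ and, for $n\ge0$, $\bar v_{n+1}=\Psi_n(\hat{\bar v}_n)$, $\bar m_{n+1}=\mathbb E[\bar v_{n+1}]$, $\bar C_{n+1}=\mathbb E[(\bar v_{n+1}-\bar m_{n+1})(\bar v_{n+1}-\bar m_{n+1})^{\mathsf T}]$, $\bar K_{n+1}=\bar C_{n+1}H^{\mathsf T}(H\bar C_{n+1}H^{\mathsf T}+\Gamma)^{-1}$, $\hat{\bar v}_{n+1}=(I-\bar K_{n+1}H)\bar v_{n+1}+\bar K_{n+1}(y_{n+1}+\tilde\eta_{n+1})$, with $\tilde\eta_{n+1}\sim N(0,\Gamma)$ independent draws. Then $\bar\mu_n$ is the law of $\hat{\bar v}_n$ (assumption (1) of the claim is the condition imposed so that it is well-defined), and $\bar\mu_n[\varphi]=\int_{\mathbb R^d}\varphi\,d\bar\mu_n$. **Four-coupled ensembles.** Fix $\boldsymbol\ell$. The construction uses, for $i=1,\dots,P_{\ell_2}$, independent particle-wise noise realizations $\omega_i^{\boldsymbol\ell}$. At $n=0$, $\hat v^{\boldsymbol\ell}_{0,i}$ are independent samples from the law of $u_0$ and $\hat v^{\boldsymbol\ell}_{0,i}=\hat v^{\boldsymbol\ell-\boldsymbol e_1}_{0,i}=\hat v^{\boldsymbol\ell-\boldsymbol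 e_2}_{0,i}=\hat v^{\boldsymbol\ell-\boldsymbol 1}_{0,i}$. Prediction (for each $i$, the four particles share the same driving noise $\omega_i^{\boldsymbol\ell}$): $v^{\boldsymbol\ell}_{n+1,i}=\Psi_n^{N_{\ell_1}}(\hat v^{\boldsymbol\ell}_{n,i})$, $v^{\boldsymbol\ell-\boldsymbol e_1}_{n+1,i}=\Psi_n^{N_{\ell_1-1}}(\hat v^{\boldsymbol\ell-\boldsymbol e_1}_{n,i})$, $v^{\boldsymbol\ell-\boldsymbol e_2}_{n+1,i}=\Psi_n^{N_{\ell_1}}(\hat v^{\boldsymbol\ell-\boldsymbol e_2}_{n,i})$, $v^{\boldsymbol\ell-\boldsymbol 1}_{n+1,i}=\Psi_n^{N_{\ell_1-1}}(\hat v^{\boldsymbol\ell-\boldsymbol 1}_{n,i})$. The ensembles on $\boldsymbol\ell$ and $\boldsymbol\ell-\boldsymbol e_1$ are single EnKF ensembles of size $P_{\ell_2}$. For $\boldsymbol j\in\{\boldsymbol\ell-\boldsymbol e_2,\boldsymbol\ell-\boldsymbol 1\}$ the particles are split into two EnKF ensembles of size $P_{\ell_2-1}=P_{\ell_2}/2$: ensemble $(\boldsymbol j,1)$ consists of particles $i=1,\dots,P_{\ell_2-1}$ and ensemble $(\boldsymbol j,2)$ of particles $i=P_{\ell_2-1}+1,\dots,P_{\ell_2}$. Update: for each EnKF ensemble with prediction particles $v_1,\dots,v_P$, let $C=\frac1P\sum_{i}v_iv_i^{\mathsf T}-\big(\frac1P\sum_iv_i\big)\big(\frac1P\sum_iv_i\big)^{\mathsf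 T}$ and $K=CH^{\mathsf T}(HCH^{\mathsf T}+\Gamma)^{-1}$. Each particle with overall number $i\in\{1,\dots,P_{\ell_2}\}$ is updated using the gain $K$ of the ensemble it belongs to: $\hat v=(I-KH)v+K\tilde y^{\boldsymbol\ell}_{n+1,i}$, where $\tilde y^{\boldsymbol\ell}_{n+1,i}=y_{n+1}+\eta^{\boldsymbol\ell}_{n+1,i}$ with $\eta^{\boldsymbol\ell}_{n+1,i}\sim N(0,\Gamma)$ i.i.d.; the same $\tilde y^{\boldsymbol\ell}_{n+1,i}$ is shared by the four particles with number $i$. **Estimators.** For $\varphi:\mathbb R^d\to\mathbb R$, $\mu_n^{\boldsymbol\ell}[\varphi]=\frac1{P_{\ell_2}}\sum_{i=1}^{P_{\ell_2}}\varphi(\hat v^{\boldsymbol\ell}_{n,i})$ is the EnKF estimator with $N_{\ell_1}$ timesteps and $P_{\ell_2}$ particles; $\mu_n^{\boldsymbol\ell-\boldsymbol e_1}[\varphi]$, $\mu_n^{\boldsymbol\ell-\boldsymbol e_2,k}[\varphi]$ and $\mu_n^{\boldsymbol\ell-\boldsymbol 1,k}[\varphi]$ ($k=1,2$) are likewise the sample averages of $\varphi$ over the corresponding coupled updated ensembles. Here $\mu_n^{\boldsymbol\ell-\boldsymbol e_2,1}[\varphi],\mu_n^{\boldsymbol\ell-\boldsymbol e_2,2}[\varphi]$ are i.i.d. copies of the EnKF estimator with index $\boldsymbol\ell-\boldsymbol e_2$, and similarly for $\boldsymbol\ell-\boldsymbol 1$. The four-coupled estimator is $$\boldsymbol\Delta\mu_n^{\boldsymbol\ell}[\varphi]=\Big(\mu_n^{\boldsymbol\ell}-\tfrac12(\mu_n^{\boldsymbol\ell-\boldsymbol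 e_2,1}+\mu_n^{\boldsymbol\ell-\boldsymbol e_2,2})-\mu_n^{\boldsymbol\ell-\boldsymbol e_1}+\tfrac12(\mu_n^{\boldsymbol\ell-\boldsymbol 1,1}+\mu_n^{\boldsymbol\ell-\boldsymbol 1,2})\Big)[\varphi],$$ where every term whose index has a negative component is set to $0$. **MIEnKF estimator.** For a finite index set $\mathcal I\subset\mathbb N_0^2$ and $M_{\boldsymbol\ell}\in\mathbb N$, $$\mu_n^{MI}[\varphi]=\sum_{\boldsymbol\ell\in\mathcal I}\sum_{m=1}^{M_{\boldsymbol\ell}}\frac{\boldsymbol\Delta\mu_n^{\boldsymbol\ell,m}[\varphi]}{M_{\boldsymbol\ell}},$$ where $\boldsymbol\Delta\mu_n^{\boldsymbol\ell,m}[\varphi]$, $m=1,\dots,M_{\boldsymbol\ell}$, are i.i.d. copies of $\boldsymbol\Delta\mu_n^{\boldsymbol\ell}[\varphi]$ and all $\boldsymbol\Delta\mu_n^{\boldsymbol\ell,m}[\varphi]$ are mutually independent over $(\boldsymbol\ell,m)$. **Cost.** $\mathrm{Cost}(\boldsymbol\Delta\mu_n^{\boldsymbol\ell}[\varphi])>0$ denotes the computational cost of one sample of $\boldsymbol\Delta\mu_n^{\boldsymbol\ell}[\varphi]$, and $\mathrm{Cost}(\mu_n^{MI}[\varphi])=\sum_{\boldsymbol\ell\in\mathcal I}M_{\boldsymbol\ell}\,\mathrm{Cost}(\boldsymbol\Delta\mu_n^{\boldsymbol\ell}[\varphi])$. **Admissible QoI.** A Borel-measurable $\varphi:\mathbb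 R^d\to\mathbb R$ is an admissible QoI if for all $n\ge0$: $\bar\mu_n[\varphi]<\infty$ (the integral existing and being finite) and $\mu_n^{\boldsymbol\ell}[\varphi]\in L^2(\Omega)$ for all $\boldsymbol\ell\in\mathbb N_0^2$.
   Formalization: The statement that the mean-field EnKF measure is the large-ensemble, fine-discretization limit of EnKF is made an explicit hypothesis: for every admissible QoI and every n, the expectation of the EnKF estimator converges to the mean-field value as both indices tend to infinity. *)

(* Defs.v *)
From HB Require Import structures.
From mathcomp Require Export all_boot all_order all_algebra.
From mathcomp Require Export all_classical all_reals all_analysis.
Export Order.TTheory GRing.Theory Num.Theory.
Export numFieldNormedType.Exports.

Set Implicit Arguments.
Unset Strict Implicit.
Unset Printing Implicit Defensive.

Local Open Scope classical_set_scope.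
Local Open Scope ring_scope.

(* The Borel sigma-algebra on matrices, in particular on R^k = 'cV[R]_k. *)
#[warning="-redundant-canonical-projection"]
HB.instance Definition _ (R : realType) (p q : nat) :=
  @isMeasurable.Build (sigma_display (@open 'M[R]_(p, q))) 'M[R]_(p, q)
    <<s @open 'M[R]_(p, q) >> (@sigma_algebra0 _ setT (@open 'M[R]_(p, q)))
    (@sigma_algebraC _ (@open 'M[R]_(p, q)))
    (@sigma_algebra_bigcup _ setT (@open 'M[R]_(p, q))).

(* f <~ g on D; extended-real valued, so that the relation also asserts that f
   is finite wherever g is. *)
Definition lesssim (R : realType) (X : Type) (D : set X) (f g : X -> \bar R) :=
  exists2 C : R, 0 < C & forall x, D x -> (f x <= C%:E * g x)%E.

Definition eqsim (R : realType) (X : Type) (D : set X) (f g : X -> \bar R) :=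
  lesssim D f g /\ lesssim D g f.

Section vectors.
Context {R : realType} {k : nat}.

Definition euclid (x : 'cV[R]_k) : R := Num.sqrt (\sum_i x i 0 ^+ 2).

Definition spd (G : 'M[R]_k) :=
  G^T = G /\ forall x : 'cV[R]_k, x != 0 -> 0 < (x^T *m G *m x) 0 0.

(* nu = N(0, G), for positive definite G: every nonzero linear functional
   a^T x is normally distributed with mean 0 and variance a^T G a. *)
Definition is_centered_gaussian (G : 'M[R]_k) (nu : probability 'cV[R]_k R) :=
  forall a : 'cV[R]_k, a != 0 -> forall B : set R, measurable B ->
    nu ((fun x => (a^T *m x) 0 0) @^-1` B) =
    normal_prob 0 (Num.sqrt ((a^T *m G *m a) 0 0)) B.

End vectors.

Section probability_notions.
Context {R : realType} {dT : measure_display} {T : measurableType dT}.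
Variable Pr : probability T R.

Definition has_law (dE : measure_display) (E : measurableType dE)
    (X : T -> E) (nu : set E -> \bar R) :=
  measurable_fun setT X /\
  forall B, measurable B -> Pr (X @^-1` B) = nu B.

Definition sigma_of (dE : measure_display) (E : measurableType dE)
    (X : T -> E) : set (set T) := preimage_set_system setT X measurable.

Definition mutually_independent (K : eqType) (D : set K)
    (G : K -> set (set T)) :=
  forall (s : seq K) (A : K -> set T), uniq s ->
    (forall k, k \in s -> D k /\ G k (A k)) ->
    Pr (\bigcap_(k in [set` s]) A k) = (\prod_(k <- s) Pr (A k))%E.

Definition rv_norm (k : nat) (p : R) (u : T -> 'cV[R]_k) : \bar R :=
  Lnorm Pr p%:E (fun t => (euclid (u t))%:E).

(* \bigcap_(p >= 2) L^p(T, R^k) for the sub-sigma-algebra G. *)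
Definition Lspace_all (k : nat) (G : set (set T)) : set (T -> 'cV[R]_k) :=
  [set u : T -> 'cV[R]_k |
     (forall B : set 'cV[R]_k, measurable B -> G (u @^-1` B)) /\
     forall p : R, 2 <= p ->
       ('E_Pr[(fun t => euclid (u t) `^ p)%R] < +oo)%E].

Definition complete_filtration (F : R -> set (set T)) :=
  [/\ measure_is_complete Pr,
      Pr.-negligible `<=` F 0,
      forall t, 0 <= t -> sigma_algebra setT (F t) /\ F t `<=` measurable &
      forall s t, 0 <= s -> s <= t -> F s `<=` F t].

Definition mean_vec (k : nat) (v : T -> 'cV[R]_k) : 'cV[R]_k :=
  \col_i \int[Pr]_t (v t i 0).

Definition cov_mx (k : nat) (v : T -> 'cV[R]_k) : 'M[R]_k :=
  \matrix_(i, j)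
    \int[Pr]_t ((v t i 0 - mean_vec v i 0) * (v t j 0 - mean_vec v j 0)).

End probability_notions.

(* Randomness driving a collection of particles numbered by i : nat, as random
   variables on a simulation space T: initial value, driving noise (a sample
   omega_i of the space Om on which the maps Psi_n are random), and
   perturbation eta_{n,i} of the observation y_n, used for n >= 1. *)
Record particle_noise (R : realType) (d m : nat) (Om T : Type) := ParticleNoise {
  init : nat -> T -> 'cV[R]_d;
  drive : nat -> T -> Om;
  pert : nat -> nat -> T -> 'cV[R]_m
}.

Section noise.
Context {R : realType} {d m : nat}.
Context {dO : measure_display} {Om : measurableType dO}.
Context {dT : measure_display} {T : measurableType dT}.
Variables (Pr : probability T R) (z : particle_noise R d m Om T).

(* inl (inl i): initial value of particle i; inl (inr i): its driving noise;
   inr (n, i): its perturbation at time n. *)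
Definition noise_sigma (k : nat + nat + nat * nat) : set (set T) :=
  match k with
  | inl (inl i) => sigma_of (init z i)
  | inl (inr i) => sigma_of (drive z i)
  | inr (n, i) => sigma_of (pert z n i)
  end.

Definition noise_used (c : nat) : set (nat + nat + nat * nat) :=
  [set k | match k with
           | inl (inl i) | inl (inr i) => (i < c)%N
           | inr (n, i) => (0 < n)%N && (i < c)%N
           end].

(* The noise of the first c particles. *)
Definition is_particle_noise (c : nat) (rho0 : set 'cV[R]_d -> \bar R)
    (P : set Om -> \bar R) (gam : set 'cV[R]_m -> \bar R) :=
  [/\ forall i, (i < c)%N -> has_law Pr (init z i) rho0,
      forall i, (i < c)%N -> has_law Pr (drive z i) P,
      forall n i, (0 < n)%N -> (i < c)%N -> has_law Pr (pert z n i) gam &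
      mutually_independent Pr (noise_used c) noise_sigma].

End noise.

Section enkf.
Context {R : realType} {d m : nat} {Om T : Type}.
Variables (H : 'M[R]_(m, d)) (Gam : 'M[R]_m) (y : nat -> 'cV[R]_m).

Definition gain (C : 'M[R]_d) : 'M[R]_(d, m) :=
  C *m H^T *m invmx (H *m C *m H^T + Gam).

Definition update (K : 'M[R]_(d, m)) (v : 'cV[R]_d) (yt : 'cV[R]_m) :=
  (1%:M - K *m H) *m v + K *m yt.

(* Sample mean and covariance of the particles a, ..., a + P - 1. *)
Definition ens_mean (a P : nat) (v : nat -> 'cV[R]_d) : 'cV[R]_d :=
  P%:R^-1 *: \sum_(a <= i < a + P) v i.

Definition ens_cov (a P : nat) (v : nat -> 'cV[R]_d) : 'M[R]_d :=
  P%:R^-1 *: \sum_(a <= i < a + P) (v i *m (v i)^T)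
  - ens_mean a P v *m (ens_mean a P v)^T.

Variable PsiN : nat -> nat -> 'cV[R]_d -> Om -> 'cV[R]_d.

(* Updated particle i at time n of the EnKF ensemble made of the particles
   a, ..., a + P - 1 of z, with N timesteps per observation interval. *)
Fixpoint enkf (z : particle_noise R d m Om T) (N a P n i : nat) (t : T) :
    'cV[R]_d :=
  if n is n'.+1 then
    let v j := PsiN n' N (enkf z N a P n' j t) (drive z j t) in
    update (gain (ens_cov a P v)) (v i) (y n + pert z n i t)
  else init z i t.

Definition ens_average (z : particle_noise R d m Om T) (N a P n : nat)
    (phi : 'cV[R]_d -> R) (t : T) : R :=
  P%:R^-1 * \sum_(a <= i < a + P) phi (enkf z N a P n i t).

Variables (N0 P0 : nat).

Definition Nl (l1 : nat) : nat := (N0 * 2 ^ l1)%N.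
Definition Pl (l2 : nat) : nat := (P0 * 2 ^ l2)%N.

(* z l is the noise used at the index l = (l1, l2). *)
Variable z : nat * nat -> particle_noise R d m Om T.

Definition enkf_est (n : nat) (l : nat * nat) (phi : 'cV[R]_d -> R) : T -> R :=
  ens_average (z l) (Nl l.1) 0 (Pl l.2) n phi.

(* The four coupled ensembles all run on the noise z l; the terms with a
   negative index are the branches equal to 0. *)
Definition coupled_est (n : nat) (l : nat * nat) (phi : 'cV[R]_d -> R)
    (t : T) : R :=
  let avg N a P := ens_average (z l) N a P n phi t in
  let: (l1, l2) := l in
  avg (Nl l1) 0%N (Pl l2)
  - (if l2 is k2.+1 then
       2^-1 * (avg (Nl l1) 0%N (Pl k2) + avg (Nl l1) (Pl k2) (Pl k2))
     else 0)
  - (if l1 is k1.+1 then avg (Nl k1) 0%N (Pl l2) else 0)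
  + (if l1 is k1.+1 then
       if l2 is k2.+1 then
         2^-1 * (avg (Nl k1) 0%N (Pl k2) + avg (Nl k1) (Pl k2) (Pl k2))
       else 0
     else 0).

End enkf.

(* Mean-field EnKF particle, driven by the noise of particle 0 of z. *)
Fixpoint mean_field (R : realType) (d m : nat) (Om : Type)
    (H : 'M[R]_(m, d)) (Gam : 'M[R]_m) (y : nat -> 'cV[R]_m)
    (Psi : nat -> 'cV[R]_d -> Om -> 'cV[R]_d)
    (dT : measure_display) (T : measurableType dT) (Pr : probability T R)
    (z : particle_noise R d m Om T) (n : nat) : T -> 'cV[R]_d :=
  if n is n'.+1 then
    let v t := Psi n' (mean_field H Gam y Psi Pr z n' t) (drive z 0%N t) in
    let K := gain H Gam (cov_mx Pr v) in
    fun t => update H K (v t) (y n + pert z n 0%N t)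
  else init z 0%N.

(* mu n l phi stands for the EnKF estimator mu_n^l[phi]. *)
Definition admissible (R : realType) (d : nat)
    (mubar : nat -> probability 'cV[R]_d R)
    (dT : measure_display) (T : measurableType dT) (Pr : probability T R)
    (mu : nat -> nat * nat -> ('cV[R]_d -> R) -> T -> R)
    (phi : 'cV[R]_d -> R) :=
  measurable_fun setT phi /\
  forall n, (mubar n).-integrable setT (EFin \o phi) /\
    forall l, mu n l phi \in Lfun Pr 2%:E.

Section multi_index.
Context {R : realType}.

Definition log2 (x : R) : R := ln x / ln 2.

(* The maximum is at least 1, hence absz only converts it to nat. *)
Definition level (L0 : nat) (eps : R) : nat :=
  absz (Num.max
    (Num.ceil (log2 eps^-1 + log2 (log2 eps^-1)) - L0%:Z) (1 : int))%R.

(* Enumeration of {l in N^2 | l1 + l2 <= L}. *)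
Definition triangle (L : nat) : seq (nat * nat) :=
  [seq l <- [seq (l1, l2) | l1 <- iota 0 L.+1, l2 <- iota 0 L.+1]
     | (l.1 + l.2 <= L)%N].

Lemma mem_triangle (L : nat) (l : nat * nat) :
  (l \in triangle L) = (l.1 + l.2 <= L)%N.
Proof.
case: l => l1 l2; rewrite mem_filter [(_, _).1]/= [(_, _).2]/=.
case: leqP => // le_l; rewrite andTb; apply/allpairsP; exists (l1, l2).
rewrite !mem_iota /= !ltnS.
by rewrite (leq_trans (leq_addr l2 l1)) ?(leq_trans (leq_addl l1 l2)).
Qed.

Lemma triangle_uniq (L : nat) : uniq (triangle L).
Proof.
by rewrite filter_uniq// allpairs_uniq ?iota_uniq// => -[? ?] [? ?] _ _ [-> ->].
Qed.

Context {dS : measure_display} {S : measurableType dS}.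

(* X l k, for l in I and k < M l, are mutually independent copies of Y l. *)
Definition independent_copies (Q : probability S R)
    (dT : measure_display) (T : measurableType dT) (Pr : probability T R)
    (I : seq (nat * nat)) (M : nat * nat -> nat)
    (Y : nat * nat -> T -> R) (X : nat * nat -> nat -> S -> R) :=
  (forall l k, l \in I -> (k < M l)%N ->
     has_law Q (X l k) (pushforward Pr (Y l))) /\
  mutually_independent Q
    [set lk : (nat * nat) * nat | lk.1 \in I /\ (lk.2 < M lk.1)%N]
    (fun lk => sigma_of (X lk.1 lk.2)).

Definition mi_est (I : seq (nat * nat)) (M : nat * nat -> nat)
    (X : nat * nat -> nat -> S -> R) (s : S) : R :=
  \sum_(l <- I) \sum_(k < M l) X l k s / (M l)%:R.

Definition mi_cost (I : seq (nat * nat)) (M : nat * nat -> nat)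
    (cost : nat * nat -> R) : R :=
  \sum_(l <- I) (M l)%:R * cost l.

End multi_index.

(* Main.v *)
(* Mean square error = variance + squared bias.
   The law of an ensemble average depends only on the number N of timesteps and
   the size P of the ensemble, since it is one fixed measurable function of P
   copies of the particle noise, whose joint law is determined by independence
   and the marginals. Hence E[Delta^l] is the mixed difference of
   g(l) = E[mu^l], the sum of E[Delta^l] over a box telescopes to g at the
   corner, and since g converges to the mean-field value, the bias of the
   estimator is the sum of E[Delta^l] off the triangle. That sum is of order
   (L + 3) 2^-L, which the choice of L makes O(eps).
   By independence the variance is the sum of V[Delta^l] / M_l. Both
   V[Delta^l] / M_l and M_l Cost_l are, up to the factors eps^2 and eps^-2,
   bounded by (N P)^(-1/2), which is summable over all indices. *)
From HB Require Import structures.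
Require Import Defs.
From mathcomp Require Import measurable_realfun ring lra zify.

Set Implicit Arguments.
Unset Strict Implicit.
Unset Printing Implicit Defensive.

Local Open Scope classical_set_scope.
Local Open Scope ring_scope.

(** * Sums over the index set *)

Section sums.
Context {R : realType}.

Lemma sum_exprn_le (x : R) n : 0 < x < 1 ->
  \sum_(i < n) x ^+ i <= (1 - x)^-1.
Proof.
move=> /andP[x0 x1]; have := @subrX1 R x n.
set s := \sum_(i < n) _ => e; rewrite -[_^-1]mul1r ler_pdivlMr ?subr_gt0//.
have -> : s * (1 - x) = 1 - x ^+ n by rewrite -[1 - x ^+ n]opprB e; ring.
by rewrite gerBl exprn_ge0// ltW.
Qed.

(** The bound comes from the exact value: the geometric series from [p] below [n] sums to 2 * 2^-p -
    2 * 2^-n, and is empty when [p] exceeds [n]. *)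
Lemma sum_half_tail p n :
  \sum_(j < n | (p <= j)%N) (2^-1 : R) ^+ j <= 2 * 2^-1 ^+ p.
Proof.
suff -> : \sum_(j < n | (p <= j)%N) (2^-1 : R) ^+ j =
    if (p <= n)%N then 2 * 2^-1 ^+ p - 2 * 2^-1 ^+ n else 0.
  case: ifP => _; last by rewrite mulr_ge0// exprn_ge0.
  by rewrite gerBl mulr_ge0// exprn_ge0.
elim: n => [|n IH].
  by rewrite big_ord0; case: ifP => //; rewrite leqn0 => /eqP->; rewrite subrr.
rewrite big_mkcond big_ord_recr -big_mkcond /= IH.
case: (ltngtP p n.+1) => [|np|->]; last by rewrite ltnn addr0 subrr.
  by rewrite ltnS => ->; rewrite exprS; field.
by rewrite leqNgt (ltn_trans _ np)//= addr0.
Qed.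

(** Summed by rows. Each of the at most L + 1 rows with i <= L contributes at most 2 * 2^-(L+1) =
    2^-L, and the rows with i > L contribute at most 2 * 2^-L together, whence the factor L + 3. *)
Lemma sum_box_tail L n :
  \sum_(i < n) \sum_(j < n | (L < i + j)%N) (2^-1 : R) ^+ (i + j) <=
    (L + 3)%:R * 2^-1 ^+ L.
Proof.
have row (i : nat) : \sum_(j < n | (L < i + j)%N) (2^-1 : R) ^+ (i + j) <=
    2 * 2^-1 ^+ (maxn i L.+1).
  under eq_bigr do rewrite exprD; rewrite -mulr_sumr.
  (* The subtraction is truncated: rows with i > L start at j = 0, which is why the exponent of the
     row bound is a maximum. *)
  rewrite (eq_bigl (fun j : 'I_n => (L.+1 - i <= j)%N)); last by move=> j; lia.
  have -> : maxn i L.+1 = (i + (L.+1 - i))%N by lia.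
  rewrite exprD mulrCA ler_wpM2l ?exprn_ge0//.
  exact: sum_half_tail.
apply: (@le_trans _ _ (\sum_(i < n) 2 * 2^-1 ^+ (maxn i L.+1))).
  by apply: ler_sum => i _; exact: row.
rewrite -mulr_sumr (bigID (fun i : 'I_n => (L < i)%N)) /=.
have hi : \sum_(i < n | (L < i)%N) (2^-1 : R) ^+ (maxn i L.+1) <= 2^-1 ^+ L.
  rewrite (eq_bigr (fun i : 'I_n => 2^-1 ^+ i)); last first.
    by move=> i Li; rewrite (maxn_idPl _).
  rewrite (le_trans (sum_half_tail L.+1 n))// exprS mulrA divff ?mul1r//.
have lo : \sum_(i < n | ~~ (L < i)%N) (2^-1 : R) ^+ (maxn i L.+1) <=
    L.+1%:R * (2^-1 * 2^-1 ^+ L).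
  rewrite (eq_bigr (fun i : 'I_n => 2^-1 ^+ L.+1)); last first.
    by move=> i; rewrite -leqNgt => Li; rewrite (maxn_idPr _)// leqW.
  suff -> : forall c : R, \sum_(i < n | ~~ (L < i)%N) c = (minn n L.+1)%:R * c.
    by rewrite -exprS ler_wpM2r ?exprn_ge0// ler_nat geq_minr.
  move=> c; rewrite -(big_mkord (fun i => ~~ (L < i)%N)).
  elim: (n) => [|k IH]; first by rewrite big_geq// min0n mul0r.
  rewrite big_mkcond big_nat_recr //= -big_mkcond IH.
  case: ifP => Lk.
    by rewrite -[X in _ + X]mul1r -mulrDl natr1; congr (_%:R * _); lia.
  by rewrite addr0; congr (_%:R * _); lia.
apply: le_trans (ler_wpM2l _ (lerD hi lo)) _ => //.
rewrite natrD -[L.+1%:R]natr1 le_eqVlt; apply/orP; left; apply/eqP; by field.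
Qed.

Lemma sum_telescope (f : nat -> R) n :
  \sum_(i < n.+1) (f i - (if (i : nat) is k.+1 then f k else 0)) = f n.
Proof.
elim: n => [|n IH]; first by rewrite big_ord_recl big_ord0 /= subr0 addr0.
by rewrite big_ord_recr /= IH addrC subrK.
Qed.

(** Deterministic counterpart of [coupled_est], with the same convention that terms at negative
    indices are 0. *)
Definition mixed_difference (g : nat * nat -> R) (l : nat * nat) : R :=
  g l - (if l.2 is k.+1 then g (l.1, k) else 0)
  - (if l.1 is k.+1 then g (k, l.2) else 0)
  + (if l.1 is k1.+1 then if l.2 is k2.+1 then g (k1, k2) else 0 else 0).

(** A mixed difference is a difference in one index of a difference in the other, so the sum
    telescopes once in each direction. *)
Lemma sum_mixed_difference (g : nat * nat -> R) n :
  \sum_(i < n.+1) \sum_(j < n.+1) mixed_difference g (i : nat, j : nat) =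
  g (n, n).
Proof.
rewrite -(sum_telescope (fun i => g (i, n))); apply: eq_bigr => i _.
rewrite -(sum_telescope (fun j => g (i : nat, j) -
  (if (i : nat) is k.+1 then g (k, j) else 0))).
apply: eq_bigr => j _; rewrite /mixed_difference /=.
by case: (i : nat) => [|k1]; case: (j : nat) => [|k2]; ring.
Qed.

(** The side [n] is free so that the triangle can be compared with arbitrarily large boxes
    containing it. *)
Lemma sum_triangle (F : nat * nat -> R) L n : (L <= n)%N ->
  \sum_(l <- triangle L) F l =
  \sum_(i < n.+1) \sum_(j < n.+1 | (i + j <= L)%N) F (i : nat, j : nat).
Proof.
move=> Ln.
pose s := [seq l <- [seq (i, j) | i <- iota 0 n.+1, j <- iota 0 n.+1]
  | (l.1 + l.2 <= L)%N].
have us : uniq s.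
  rewrite filter_uniq// allpairs_uniq ?iota_uniq//.
  by move=> -[? ?] [? ?] _ _ [-> ->].
rewrite (perm_big s); last first.
  apply: uniq_perm => //; first exact: triangle_uniq.
  case=> i j; rewrite mem_triangle mem_filter; case: leqP => //= ijL.
  have -> // : (i, j) \in [seq (i, j) | i <- iota 0 n.+1, j <- iota 0 n.+1].
  by apply/allpairsP; exists (i, j); rewrite !mem_iota /=; split => //; lia.
have iotaE : iota 0 n.+1 = index_iota 0 n.+1 by rewrite /index_iota subn0.
rewrite big_filter big_mkcond big_allpairs_dep iotaE big_mkord /=.
by apply: eq_bigr => i _; rewrite big_mkord [RHS]big_mkcond.
Qed.

(** Enlarging the triangle to a square makes the sum a product of two geometric sums. *)
Lemma sum_triangle_le (x : R) L : 0 < x < 1 ->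
  \sum_(l <- triangle L) x ^+ (l.1 + l.2) <= (1 - x)^-1 ^+ 2.
Proof.
move=> x01; have /andP[x0 x1] := x01.
rewrite (sum_triangle _ (leqnn L)).
apply: (@le_trans _ _ (\sum_(i < L.+1) x ^+ i * \sum_(j < L.+1) x ^+ j)).
  apply: ler_sum => i _; rewrite mulr_sumr big_mkcond.
  apply: ler_sum => j _ /=; rewrite exprD; case: ifP => // _.
  by rewrite mulr_ge0// exprn_ge0// ltW.
rewrite -mulr_suml expr2; apply: ler_pM; rewrite ?sum_exprn_le//;
  by apply: sumr_ge0 => i _; rewrite exprn_ge0// ltW.
Qed.

Lemma sum_off_triangle_le (F : nat * nat -> R) c L n : (L <= n)%N -> 0 <= c ->
  (forall l, `|F l| <= c * 2^-1 ^+ (l.1 + l.2)) ->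
  `|\sum_(i < n.+1) \sum_(j < n.+1) F (i : nat, j : nat)
     - \sum_(l <- triangle L) F l| <= c * ((L + 3)%:R * 2^-1 ^+ L).
Proof.
move=> Ln c0 Fc; rewrite (sum_triangle _ Ln) -sumrB.
apply: le_trans (ler_wpM2l c0 (sum_box_tail L n.+1)).
rewrite mulr_sumr; apply: (le_trans (ler_norm_sum _ _ _)).
apply: ler_sum => i _.
rewrite (bigID (fun j : 'I_n.+1 => (i + j <= L)%N)) /= addrC addrK.
rewrite (eq_bigl (fun j : 'I_n.+1 => (L < i + j)%N)); last first.
  by move=> j; rewrite ltnNge.
rewrite mulr_sumr; apply: (le_trans (ler_norm_sum _ _ _)).
apply: ler_sum => j _.
exact: Fc.
Qed.

End sums.

(** * The level L and the exponents of N and P *)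

Section level.
Context {R : realType}.

(** This is ln (1 + x) <= x at x = -1/2. *)
Lemma ln2_gt_half : (2^-1 : R) <= ln 2.
Proof.
have := @le_ln1Dx R (- 2^-1); rewrite (_ : 1 - 2^-1 = 2^-1 :> R); last by lra.
rewrite lnV ?posrE//; lra.
Qed.

Lemma half_exprn_expR L : (2^-1 : R) ^+ L = expR (- (L%:R * ln 2)).
Proof. by rewrite expRN expRM_natl lnK ?posrE// exprVn. Qed.

(** Put t = log2 (1 / eps). If t >= 1, then L <= 3 t + 1, so L + 3 <= 7 t, while L >= t + log2 t -
    [L0] gives 2^-L <= 2^L0 * eps / t. The iterated logarithm in [level] supplies the 1 / t that
    cancels the linear factor. *)
Lemma level_le L0 (eps : R) : 0 < eps < 1 ->
  (level L0 eps + 3)%:R * 2^-1 ^+ level L0 eps <= 7 * 2 ^+ L0 * eps.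
Proof.
move=> /andP[e0 e1]; rewrite /level.
have l2 := ln2_gt_half; have l20 : 0 < ln (2 : R) by lra.
set t := log2 eps^-1.
have tE : t * ln 2 = ln eps^-1 by rewrite /t /log2 divfK// gt_eqF.
have tE' : t * ln 2 = - ln eps by rewrite tE lnV ?posrE.
have t0 : 0 < t by rewrite /t /log2 divr_gt0// ln_gt0// invf_gt1.
set z := (Num.ceil (t + log2 t) - L0%:Z)%R.
have L1 : (1 : R) <= 2 ^+ L0 by rewrite exprn_ege1// ler1n.
(* If t < 1 the maximum in level is attained by 1, and eps > 1 / 2. *)
have [t1|t1] := leP 1 t.
  set L := absz _.
  have LE : (L%:Z = Num.max z 1)%R.
    by rewrite /L gez0_abs// le_max ler01 orbT.
  have LEr : L%:R = (Num.max z 1)%:~R :> R by rewrite -LE.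
  (* From ln t <= t - 1 and ln 2 >= 1/2. *)
  have lt : log2 t <= 2 * t.
    rewrite /log2 ler_pdivrMr//.
    have := @le_ln1Dx R (t - 1); rewrite (_ : 1 + (t - 1) = t); last by lra.
    by move=> /(_ _)/le_trans; apply; nra.
  have L3t : (L%:R : R) <= 3 * t + 1.
    rewrite LEr; have := ceilB1_lt (t + log2 t); rewrite intrB => cl.
    case: (leP z 1) => _; first by rewrite mulr1z; lra.
    rewrite /z intrB; have : 0 <= (L0%:Z)%:~R :> R by rewrite ler0z.
    lra.
  have Lge : t + log2 t - L0%:R <= L%:R.
    rewrite LEr; apply: (@le_trans _ _ z%:~R).
      by rewrite /z intrB lerD2r ceil_ge.
    by rewrite ler_int le_max lexx.
  have hL : 2^-1 ^+ L <= 2 ^+ L0 * eps / t :> R.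
    rewrite half_exprn_expR.
    apply: (@le_trans _ _ (expR (- ((t + log2 t - L0%:R) * ln 2)))).
      by rewrite ler_expR lerN2 ler_wpM2r// ltW.
    rewrite (_ : - _ = L0%:R * ln 2 + ln eps - ln t).
      by rewrite !expRD expRN expRM_natl !lnK ?posrE.
    have : log2 t * ln 2 = ln t by rewrite /log2 divfK// gt_eqF.
    by move: tE'; clear; lra.
  apply: (@le_trans _ _ ((7 * t) * (2 ^+ L0 * eps / t))); last first.
    by rewrite le_eqVlt; apply/orP; left; apply/eqP; field; rewrite gt_eqF.
  apply: ler_pM => //.
  by move: L3t t1; rewrite natrD; move: L%:R => n; clear; lra.
have z1 : z <= 1.
  have : (Num.ceil (t + log2 t) <= 1)%R.
    rewrite ceil_le_int mulr1z.
    have : log2 t <= 0.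
      by rewrite /log2 mulr_le0_ge0 ?invr_ge0 ?(ltW l20)// ln_le0 ?ltW.
    lra.
  by rewrite /z; lia.
(* With L = 1 the left side is 4 / 2 = 2, below 7 * eps because eps > 1/2. *)
rewrite (max_idPr z1) /= expr1.
have : 2^-1 < eps.
  rewrite -ltr_ln ?posrE// lnV ?posrE//.
  have : t * ln 2 < ln 2 by rewrite gtr_pMl.
  by move: tE'; lra.
by nra.
Qed.

(* Common ratio of the geometric bounds on variance and cost. *)
Definition half_root : R := 2 `^ (- (1 / 2)).

Lemma half_root_itv : 0 < half_root < 1.
Proof.
rewrite powR_gt0//= /half_root powRN invf_lt1 ?powR_gt0//.
have half0 : (0 : R) < 1 / 2 by rewrite divr_gt0.
have := gt0_ltr_powR half0 (x := 1) (y := 2); rewrite powR1; apply=> //.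
- by rewrite nnegrE.
- by rewrite nnegrE.
- by rewrite ltr1n.
Qed.

(** The factor a^(-1/2) is at most 1 because a >= 1; the power of 2 gives the geometric term. *)
Lemma powR_half_scale (a : nat) l : (0 < a)%N ->
  (a * 2 ^ l)%:R `^ (- (1 / 2)) <= half_root ^+ l.
Proof.
move=> a0; rewrite natrM natrX powRM// -[X in _ <= X]mul1r ler_pM ?powR_ge0//.
  rewrite powRN invf_le1 ?powR_gt0 ?ltr0n//.
  have half0 : (0 : R) <= 1 / 2 by rewrite divr_ge0.
  have := ge0_ler_powR half0 (x := 1) (y := a%:R); rewrite powR1; apply=> //.
  - by rewrite nnegrE.
  - by rewrite nnegrE.
  - by rewrite ler1n.
rewrite /half_root -(powR_mulrn l) ?powR_ge0// -powRrM.
by rewrite -(powR_mulrn l)// -powRrM mulrC.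
Qed.

(** Here [x] is N or P: the number of samples carries x^(-3/2) and the cost of one sample carries
    x. *)
Lemma powR_cost (x : R) : 0 < x -> x `^ (- (3 / 2)) * x = x `^ (- (1 / 2)).
Proof.
move=> x0; rewrite -[X in _ * X](powRr1 (ltW x0)).
rewrite -powRD ?(gt_eqF x0) ?implybT//.
by congr (_ `^ _); lra.
Qed.

(** Dividing the variance factor x^-2 by the sample factor x^(-3/2) leaves x^(-1/2), the same
    exponent as for the cost. *)
Lemma powR_var (x : R) : 0 < x -> x ^- 2 = x `^ (- (1 / 2)) * x `^ (- (3 / 2)).
Proof.
move=> x0; rewrite -powRD ?(gt_eqF x0) ?implybT//.
rewrite -(powR_mulrn 2 (ltW x0)) -powRN.
by congr (_ `^ _); lra.
Qed.

End level.

(** * Moments of independent copies *)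

Section equal_law.
Context {R : realType} {dS dT : measure_display}
  {S : measurableType dS} {T : measurableType dT}.
Variables (Q : probability S R) (P : probability T R).
Variables (X : S -> R) (Y : T -> R).
Hypotheses (mY : measurable_fun setT Y) (XY : has_law Q X (pushforward P Y)).

Let mX : measurable_fun setT X := XY.1.

Let X' : {RV Q >-> R} := mfun_Sub (mem_set mX).
Let Y' : {RV P >-> R} := mfun_Sub (mem_set mY).

(** Both sides are integrals of [f] against the common image measure on the line. *)
Lemma has_law_ge0_integral (f : R -> \bar R) : measurable_fun setT f ->
  (forall x, 0 <= f x)%E -> (\int[Q]_s f (X s) = \int[P]_t f (Y t))%E.
Proof.
move=> mf f0.
rewrite -(ge0_integral_distribution X' mf f0).
rewrite -(ge0_integral_distribution Y' mf f0).
by apply: eq_measure_integral => A mA _; exact: XY.2.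
Qed.

Lemma has_law_integrable (f : R -> \bar R) : measurable_fun setT f ->
  P.-integrable setT (f \o Y) -> Q.-integrable setT (f \o X).
Proof.
move=> mf /integrableP[_ fY]; apply/integrableP; split.
  exact: measurableT_comp.
rewrite (has_law_ge0_integral (f := fun x => `|f x|%E))//.
exact: measurableT_comp.
Qed.

Lemma has_law_integral (f : R -> \bar R) : measurable_fun setT f ->
  P.-integrable setT (f \o Y) -> (\int[Q]_s f (X s) = \int[P]_t f (Y t))%E.
Proof.
move=> mf fY.
rewrite -(integral_distribution (X := X') mf (has_law_integrable mf fY)).
rewrite -(integral_distribution (X := Y') mf fY).
by apply: eq_measure_integral => A mA _; exact: XY.2.
Qed.

Lemma has_law_Lfun2 : Y \in Lfun P 2%:E -> X \in Lfun Q 2%:E.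
Proof.
rewrite !inE => /andP[_]; rewrite inE /= => fY.
apply/andP; split; rewrite inE //=.
move: fY; rewrite /finite_norm unlock.
have := has_law_ge0_integral (f := fun x => (`|x%:E| `^ 2)%E).
rewrite /= => -> //; apply/measurable_EFinP.
apply/(@measurableT_comp _ _ _ _ _ _ (fun x : R => x `^ 2)) => //.
Qed.

Lemma has_law_expectation : Y \in Lfun P 1 -> ('E_Q[X] = 'E_P[Y])%E.
Proof.
move=> /Lfun1_integrable iY; rewrite unlock.
by rewrite (has_law_integral (f := EFin)).
Qed.

End equal_law.

Lemma Lfun2_Lfun1 (R : realType) d (T : measurableType d) (P : probability T R)
  (X : T -> R) : X \in Lfun P 2%:E -> X \in Lfun P 1.
Proof. by apply: Lfun_subset12; exact: fin_num_measure. Qed.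

Lemma Lfun_measurable (R : realType) d (T : measurableType d)
  (P : probability T R) p (X : T -> R) :
  X \in Lfun P p -> measurable_fun setT X.
Proof. by rewrite inE => /andP[+ _]; rewrite inE. Qed.

Lemma has_law_variance (R : realType) (dS dT : measure_display)
    (S : measurableType dS) (T : measurableType dT)
    (Q : probability S R) (P : probability T R) (X : S -> R) (Y : T -> R) :
  has_law Q X (pushforward P Y) -> Y \in Lfun P 2%:E -> ('V_Q[X] = 'V_P[Y])%E.
Proof.
move=> XY Y2; have mY := Lfun_measurable Y2.
rewrite !varianceE//; last exact: has_law_Lfun2 XY Y2.
rewrite (has_law_expectation mY XY) ?Lfun2_Lfun1//; congr (_ - _)%E.
rewrite unlock (has_law_integral mY XY (f := fun x => (x ^+ 2)%:E))//.
  by apply/measurable_EFinP; exact: exprn_measurable.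
exact: Lfun2_integrable_sqr.
Qed.

(** * Independence, covariance and variance of sums *)

Section covariance_independent.
Context {R : realType} {d : measure_display} {S : measurableType d}.
Variable Q : probability S R.

(** The law of the pair agrees with the product of the marginals on rectangles, hence everywhere;
    Fubini then gives E[XY] = E[X] E[Y]. *)
Lemma independent_covariance0 (X Y : S -> R) :
  (forall A B : set R, measurable A -> measurable B ->
     Q (X @^-1` A `&` Y @^-1` B) = (Q (X @^-1` A) * Q (Y @^-1` B))%E) ->
  X \in Lfun Q 2%:E -> Y \in Lfun Q 2%:E -> covariance Q X Y = 0%E.
Proof.
move=> indep X2 Y2.
have [mX mY] := (Lfun_measurable X2, Lfun_measurable Y2).
have [X1 Y1] := (Lfun2_Lfun1 X2, Lfun2_Lfun1 Y2).
have XY1 := Lfun2_mul_Lfun1 X2 Y2.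
rewrite covarianceE//.
pose X' : {RV Q >-> R} := mfun_Sub (mem_set mX).
pose Y' : {RV Q >-> R} := mfun_Sub (mem_set mY).
have mZ : measurable_fun setT (fun s => (X s, Y s)).
  exact: measurable_fun_pair.
pose Z' : {RV Q >-> (R * R)%type} := mfun_Sub (mem_set mZ).
have mf : measurable_fun setT (fun x : R * R => (x.1 * x.2)%:E).
  by apply/measurable_EFinP; apply: measurable_funM.
have law A : measurable A ->
    distribution Q Z' A = (distribution Q X' \x distribution Q Y')%E A.
  by move=> mA; apply/esym; apply: product_measure_unique.
have iXY : Q.-integrable setT ((fun x : R * R => (x.1 * x.2)%:E) \o Z').
  by move/Lfun1_integrable : XY1.
(* Fubini requires integrability for the product measure; it is transported from XY in L^1 through
   [law]. *)
have iP : (distribution Q X' \x distribution Q Y')%E.-integrable setT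
    (fun x : R * R => (x.1 * x.2)%:E).
  apply/integrableP; split => //.
  rewrite (eq_measure_integral (distribution Q Z')) => [|A mA _];
    last exact/esym/law.
  rewrite ge0_integral_distribution//; last exact: measurableT_comp.
  by move/integrableP : iXY => [].
rewrite unlock.
have -> : (\int[Q]_s ((X * Y) s)%:E =
    \int[distribution Q Z']_x (x.1 * x.2)%:E)%E.
  by rewrite integral_distribution.
rewrite (eq_measure_integral (distribution Q X' \x distribution Q Y')%E)
  => [|A mA _]; last exact: law.
rewrite -integral12_prod_meas1//.
have iX : Q.-integrable setT (EFin \o X) by exact/Lfun1_integrable.
have iY : Q.-integrable setT (EFin \o Y) by exact/Lfun1_integrable.
have iY' : (distribution Q Y').-integrable setT EFin.
  exact: (integrable_pushforward mY (f := EFin)).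
have [c EYc] : exists c, 'E_Q[Y]%E = c%:E.
  by exists (fine 'E_Q[Y]%E); rewrite fineK// expectation_fin_num.
have inner x : (\int[distribution Q Y']_y (x * y)%:E = (x * c)%:E)%E.
  under eq_integral do rewrite EFinM.
  by rewrite integralZl// integral_distribution// EFinM -EYc unlock.
rewrite /fubini_F /=; under eq_integral do rewrite inner.
have mc : measurable_fun setT (fun x : R => (x * c)%:E).
  by apply/measurable_EFinP; apply: measurable_funM.
have ic : Q.-integrable setT ((fun x : R => (x * c)%:E) \o X).
  exact: (integrableZr _ c iX).
rewrite (integral_distribution (X := X') mc ic) /=.
under eq_integral do rewrite EFinM; rewrite integralZr//.
move: EYc; rewrite unlock => ->.
have := expectation_fin_num X1; rewrite unlock => fX.
by rewrite subee// fin_numM.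
Qed.

Lemma Lfun2_sum (K : eqType) (s : seq K) (W : K -> S -> R) :
  (forall k, k \in s -> W k \in Lfun Q 2%:E) ->
  \sum_(k <- s) W k \in Lfun Q 2%:E.
Proof. by move=> W2; rewrite big_seq rpred_sum// lee1n. Qed.

Lemma covariance_sumr (K : eqType) (s : seq K) (W : K -> S -> R) (X : S -> R) :
  X \in Lfun Q 2%:E -> (forall k, k \in s -> W k \in Lfun Q 2%:E) ->
  (forall k, k \in s -> covariance Q X (W k) = 0%E) ->
  covariance Q X (\sum_(k <- s) W k) = 0%E.
Proof.
move=> X2; elim: s => [|k s IH] W2 cov0.
  by rewrite big_nil; exact: covariance_cst_r.
have W2s l : l \in s -> W l \in Lfun Q 2%:E.
  by move=> ls; rewrite W2// inE ls orbT.
rewrite big_cons covarianceDr//; last 2 first.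
- by rewrite W2// mem_head.
- exact: Lfun2_sum.
rewrite cov0 ?mem_head// add0e IH// => l ls.
by rewrite cov0// inE ls orbT.
Qed.

Lemma variance_sum (K : eqType) (s : seq K) (W : K -> S -> R) :
  uniq s -> (forall k, k \in s -> W k \in Lfun Q 2%:E) ->
  {in s &, forall k l, k != l -> covariance Q (W k) (W l) = 0%E} ->
  ('V_Q[(\sum_(k <- s) W k)%R] = \sum_(k <- s) 'V_Q[W k])%E.
Proof.
elim: s => [|k s IH] /= us W2 cov0.
  by rewrite !big_nil; exact: variance_cst.
have W2s l : l \in s -> W l \in Lfun Q 2%:E.
  by move=> ls; rewrite W2// inE ls orbT.
case/andP: us => ks us.
rewrite !big_cons varianceD; last 2 first.
- by rewrite W2// mem_head.
- exact: Lfun2_sum.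
rewrite IH//; last by move=> i j si sj; apply: cov0; rewrite inE ?si ?sj orbT.
rewrite covariance_sumr ?mule0 ?adde0//; first by rewrite W2// mem_head.
move=> l ls; apply: cov0; rewrite ?mem_head//; first by rewrite inE ls orbT.
by apply: contraNneq ks => ->.
Qed.

Lemma expectation_sum_seq (K : eqType) (s : seq K) (W : K -> S -> R) :
  (forall k, k \in s -> W k \in Lfun Q 1) ->
  ('E_Q[(\sum_(k <- s) W k)%R] = \sum_(k <- s) 'E_Q[W k])%E.
Proof.
move=> W1; rewrite -!(big_map W predT id) expectation_sum; last first.
  by move=> _ /mapP[k ks ->]; exact: W1.
by rewrite big_map.
Qed.

(** Shifting by [c] does not change the variance, so it suffices to expand the variance of X - c. *)
Lemma mean_square_error (X : S -> R) (c : R) : X \in Lfun Q 2%:E ->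
  ('E_Q[(fun s => (X s - c) ^+ 2)%R] = 'V_Q[X] + ('E_Q[X] - c%:E) ^+ 2)%E.
Proof.
move=> X2; have X1 := Lfun2_Lfun1 X2.
have Xc2 : (X \- cst c)%R \in Lfun Q 2%:E.
  by have c2 := Lfun_cst Q c 2; rewrite rpredB ?lee1n.
rewrite -(varianceB_cst_r c X2) varianceE// expectationB ?Lfun_cst//.
rewrite expectation_cst subeK// fin_numX// fin_numB expectation_fin_num//.
Qed.

End covariance_independent.

(** * Mean and variance of the multi-index estimator *)

Section independent_copies.
Context {R : realType} {dS dT : measure_display}
  {S : measurableType dS} {T : measurableType dT}.
Variables (Q : probability S R) (P : probability T R).
Variables (I : seq (nat * nat)) (M : nat * nat -> nat).
Variables (Y : nat * nat -> T -> R) (X : nat * nat -> nat -> S -> R).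
Hypotheses (uI : uniq I) (M0 : forall l, l \in I -> (0 < M l)%N).
Hypothesis Y2 : forall l, l \in I -> Y l \in Lfun P 2%:E.
Hypothesis XY : independent_copies Q P I M Y X.

(** The double sum is flattened into one sum over pairs (index, sample), with the weight 1 / M_l
    absorbed in [W], so that independence is used on a single family. *)
Let s := [seq (l, k) | l <- I, k <- iota 0 (M l)].

Let W (lk : (nat * nat) * nat) : S -> R :=
  (M lk.1)%:R^-1 \o* X lk.1 lk.2.

Let mem_s l k : (l, k) \in s = (l \in I) && (k < M l)%N.
Proof.
apply/allpairsPdep/andP => [[l' [k' [lI kM [-> ->]]]]|[lI kM]].
  by move: kM; rewrite mem_iota.
by exists l, k; rewrite mem_iota.
Qed.

Let s_uniq : uniq s.
Proof.
apply: allpairs_uniq_dep => // [l _|[? ?] [? ?] _ _ [-> ->]]//.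
exact: iota_uniq.
Qed.

Let mi_estE : mi_est I M X = \sum_(lk <- s) W lk.
Proof.
apply/funext => t; rewrite fct_sumE big_allpairs_dep /=.
apply: eq_bigr => l _.
by rewrite -(big_mkord xpredT (fun k => X l k t / (M l)%:R)) /index_iota subn0.
Qed.

Let X2 l k : l \in I -> (k < M l)%N -> X l k \in Lfun Q 2%:E.
Proof.
move=> lI kM; apply: (has_law_Lfun2 _ (XY.1 _ _ lI kM) (Y2 lI)).
exact: Lfun_measurable (Y2 lI).
Qed.

Let W2 lk : lk \in s -> W lk \in Lfun Q 2%:E.
Proof.
case: lk => l k; rewrite mem_s => /andP[lI kM].
by apply: Lfun_scale; rewrite ?ler1n ?X2.
Qed.

Lemma mi_est_Lfun2 : mi_est I M X \in Lfun Q 2%:E.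
Proof. by rewrite mi_estE; apply: Lfun2_sum => lk; exact: W2. Qed.

Let covX (lk lk' : (nat * nat) * nat) : lk \in s -> lk' \in s -> lk != lk' ->
  covariance Q (X lk.1 lk.2) (X lk'.1 lk'.2) = 0%E.
Proof.
case: lk lk' => l k [l' k'].
rewrite !mem_s => /andP[lI kM] /andP[lI' kM'] neq /=.
apply: independent_covariance0; [|exact: X2..] => A B mA mB.
(* Mutual independence is applied to a two-element subfamily; the test on [(l, k)] assigns A to one
   key and B to the other. *)
have := XY.2 [:: (l, k); (l', k')]
  (fun lk => if lk == (l, k) then X l k @^-1` A else X l' k' @^-1` B).
rewrite /= inE neq /= => /(_ erefl).
rewrite !big_cons big_nil mule1 eqxx eq_sym (negbTE neq) => <-.
  congr (Q _); apply/seteqP; split=> t.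
    by move=> [tA tB] lk /=; rewrite !inE; case: ifP.
  move=> h; split.
    by have := h (l, k); rewrite /= eqxx; apply; rewrite mem_head.
  have := h (l', k'); rewrite /= eq_sym (negbTE neq); apply.
  by rewrite !inE eqxx orbT.
move=> lk; rewrite !inE => /orP[]/eqP->; rewrite ?eqxx 1?eq_sym ?(negbTE neq);
  (split; first by []).
  by exists A; rewrite ?setTI.
by exists B; rewrite ?setTI.
Qed.

Lemma expectation_mi_est : ('E_Q[mi_est I M X] = \sum_(l <- I) 'E_P[Y l])%E.
Proof.
rewrite mi_estE expectation_sum_seq; last first.
  by move=> lk lks; exact/Lfun2_Lfun1/W2.
rewrite big_allpairs_dep big_seq [RHS]big_seq; apply: eq_bigr => l lI.
rewrite (eq_big_seq (fun=> (M l)%:R^-1%:E * 'E_P[Y l])%E); last first.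
  move=> k; rewrite mem_iota /= => kM; rewrite expectationZl ?Lfun2_Lfun1 ?X2//.
  rewrite (has_law_expectation _ (XY.1 _ _ lI kM)) ?Lfun2_Lfun1 ?Y2//.
  exact: Lfun_measurable (Y2 lI).
rewrite -(fineK (expectation_fin_num (Lfun2_Lfun1 (Y2 lI)))) -EFinM sumEFin.
rewrite big_const_seq count_predT size_iota iter_addr_0.
by rewrite -mulrnAl -[_ *+ M l]mulr_natl mulfV ?mul1r// pnatr_eq0 -lt0n M0.
Qed.

(** The terms are pairwise uncorrelated; each of the M_l copies carries the squared weight 1 /
    M_l^2, which leaves 1 / M_l. *)
Lemma variance_mi_est :
  ('V_Q[mi_est I M X] = \sum_(l <- I) (M l)%:R^-1%:E * 'V_P[Y l])%E.
Proof.
rewrite mi_estE variance_sum//; last first.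
  move=> [l k] [l' k'] ls ls' neq; rewrite /W /=.
  have := covX ls ls' neq; move: ls ls'.
  rewrite !mem_s => /andP[lI kM] /andP[lI' kM'] /= cov0.
  have [XX XX'] := (X2 lI kM, X2 lI' kM').
  have [X1 X1'] := (Lfun2_Lfun1 XX, Lfun2_Lfun1 XX').
  rewrite covarianceZl//; last 2 first.
  - by rewrite Lfun_scale.
  - by apply: Lfun2_mul_Lfun1 => //; apply: Lfun_scale; rewrite ?ler1n.
  by rewrite covarianceZr ?cov0 ?mule0// Lfun2_mul_Lfun1.
rewrite big_allpairs_dep big_seq [RHS]big_seq; apply: eq_bigr => l lI.
rewrite (eq_big_seq (fun=> ((M l)%:R^-1 ^+ 2)%:E * 'V_P[Y l])%E); last first.
  move=> k; rewrite mem_iota /= => kM; rewrite varianceZ ?X2//.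
  by rewrite (has_law_variance (XY.1 _ _ lI kM)) ?Y2.
rewrite -(fineK (variance_fin_num (Y2 lI))) -!EFinM sumEFin.
rewrite big_const_seq count_predT size_iota iter_addr_0.
rewrite -mulrnAl expr2 -mulrnAl -[_ *+ M l]mulr_natl.
by rewrite mulfV ?mul1r// pnatr_eq0 -lt0n M0.
Qed.

End independent_copies.

(** * Borel measurability of matrix operations *)

(** Inversion is continuous on the open set of nonzero reals, and on the remaining singleton every
    function is measurable. *)
Lemma measurable_fun_inv (R : realType) : measurable_fun setT (@GRing.inv R).
Proof.
have -> : [set: R] = [set x : R | x != 0] `|` [set 0].
  by apply/seteqP; split=> x //= _; have [->|x0] := eqVneq x 0; [right|left].
have oD : open [set x : R | x != 0].
  rewrite (_ : [set x | _] = ~` [set 0]); last first.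
    by apply/seteqP; split=> x /=; [move=> /eqP|move=> ?; apply/eqP].
  exact/closed_openC/closed_eq.
apply: (measurable_funU _ (open_measurable oD) (measurable_set1 0)).2; split.
  apply: open_continuous_measurable_fun => // x; rewrite inE /= => x0.
  exact: inv_continuous.
exact: measurable_fun_set1.
Qed.

Section matrix_measurability.
Context {R : realType}.

Lemma measurable_mxE (p q : nat) (i : 'I_p) (j : 'I_q) :
  measurable_fun setT (fun A : 'M[R]_(p, q) => A i j).
Proof.
apply: (measurability _ (RGenOpens.measurableE R)) => _ [_ [a [b ->] <-]].
rewrite setTI; apply: sub_sigma_algebra; apply: open_comp; last first.
  exact: interval_open.
by move=> A _; exact: coord_continuous.
Qed.

(** The boxes have rational centres and radii 1 / (n + 1), so there are countably many of them. This
    reduces Borel measurability of a matrix-valued map to that of its entries. *)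
Lemma open_mx_bigcup (p q : nat) (U : set 'M[R]_(p, q)) (box :=
    fun (x : 'M[rat]_(p, q) * nat) (A : 'M[R]_(p, q)) =>
      forall i j, `|ratr (x.1 i j) - A i j| < x.2.+1%:R^-1) :
  open U -> U = \bigcup_(x in [set x | box x `<=` U]) box x.
Proof.
move=> oU; apply/seteqP; split=> A; last by case=> x h; exact: h.
move=> UA; have /nbhs_ballP[e /= e0 eU] : nbhs A U by exact: open_nbhs_nbhs.
(* Half the radius: both A and any B in the box lie within e / 2 of the rational centre, entry by
   entry. *)
have e20 : 0 < e / 2 by rewrite divr_gt0.
have [n _ /(_ _ (leqnn n)) /= ne] := near_infty_natSinv_lt (PosNum e20).
have ratP (a : R) : exists r : rat, `|ratr r - a| < n.+1%:R^-1.
  have /rat_in_itvoo[r] : a < a + n.+1%:R^-1 by rewrite ltrDl invr_gt0.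
  rewrite in_itv /= => /andP[ar ra]; exists r.
  by rewrite gtr0_norm ?subr_gt0// ltrBlDl.
exists (\matrix_(i, j) xchoose (ratP (A i j)), n) => [B boxB|i j]; last first.
  by rewrite mxE; exact: xchooseP (ratP (A i j)).
apply: eU; split => // i j; rewrite /ball /=.
have := boxB i j; rewrite mxE; have := xchooseP (ratP (A i j)).
move: (xchoose _) => r rA rB; rewrite (splitr e).
rewrite (le_lt_trans (ler_distD (ratr r) _ _))// ltrD//.
  by rewrite distrC (lt_trans rA).
exact: lt_trans ne.
Qed.

Context {d : measure_display} {T : measurableType d}.

Lemma measurable_fun_mx (p q : nat) (f : T -> 'M[R]_(p, q)) :
  (forall i j, measurable_fun setT (fun t => f t i j)) -> measurable_fun setT f.
Proof.
move=> mf; apply: (measurability _ (erefl :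
  @measurable _ 'M[R]_(p, q) = <<s @open 'M[R]_(p, q) >>)).
  move=> _ [U oU <-]; rewrite setTI.
rewrite (open_mx_bigcup oU) preimage_bigcup bigcup_mkcond.
apply: countable_bigcupT_measurable => // x; case: ifP => // _.
rewrite (_ : _ @^-1` _ = \bigcap_(i in [set: 'I_p]) \bigcap_(j in [set: 'I_q])
    (fun t => `|ratr (x.1 i j) - f t i j|) @^-1` `]-oo, x.2.+1%:R^-1[);
    last first.
  apply/seteqP; split=> t /=.
    by move=> h i _ j _ /=; rewrite in_itv /=; exact: h.
  by move=> h i j; have := h i I j I; rewrite /= in_itv.
apply: fin_bigcap_measurable => // i _; apply: fin_bigcap_measurable => // j _.
rewrite -[X in measurable X]setTI.
have m2 : measurable_fun setT (fun t => `|ratr (x.1 i j) - f t i j|).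
  by apply: measurableT_comp => //; apply: measurable_funB.
exact: m2.
Qed.

Lemma measurable_fun_mxE (p q : nat) (f : T -> 'M[R]_(p, q)) i j :
  measurable_fun setT f -> measurable_fun setT (fun t => f t i j).
Proof. by move=> mf; exact: (measurableT_comp (measurable_mxE i j) mf). Qed.

Lemma measurable_fun_addmx (p q : nat) (f g : T -> 'M[R]_(p, q)) :
  measurable_fun setT f -> measurable_fun setT g ->
  measurable_fun setT (fun t => f t + g t).
Proof.
move=> mf mg; apply: measurable_fun_mx => i j; under eq_fun do rewrite mxE.
by apply: measurable_funD; exact: measurable_fun_mxE.
Qed.

Lemma measurable_fun_oppmx (p q : nat) (f : T -> 'M[R]_(p, q)) :
  measurable_fun setT f -> measurable_fun setT (fun t => - f t).
Proof.
move=> mf; apply: measurable_fun_mx => i j; under eq_fun do rewrite mxE.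
by apply: measurable_funN; exact: measurable_fun_mxE.
Qed.

Lemma measurable_fun_mulmx (p q r : nat) (f : T -> 'M[R]_(p, q))
    (g : T -> 'M[R]_(q, r)) :
  measurable_fun setT f -> measurable_fun setT g ->
  measurable_fun setT (fun t => f t *m g t).
Proof.
move=> mf mg; apply: measurable_fun_mx => i j; under eq_fun do rewrite mxE.
apply: measurable_sum => k.
by apply: measurable_funM; exact: measurable_fun_mxE.
Qed.

Lemma measurable_fun_scalemx (p q : nat) (a : T -> R) (f : T -> 'M[R]_(p, q)) :
  measurable_fun setT a -> measurable_fun setT f ->
  measurable_fun setT (fun t => a t *: f t).
Proof.
move=> ma mf; apply: measurable_fun_mx => i j; under eq_fun do rewrite mxE.
by apply: measurable_funM => //; exact: measurable_fun_mxE.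
Qed.

Lemma measurable_fun_trmx (p q : nat) (f : T -> 'M[R]_(p, q)) :
  measurable_fun setT f -> measurable_fun setT (fun t => (f t)^T).
Proof.
move=> mf; apply: measurable_fun_mx => i j; under eq_fun do rewrite mxE.
exact: measurable_fun_mxE.
Qed.

Lemma measurable_fun_summx (p q : nat) (I : Type) (s : seq I)
    (f : I -> T -> 'M[R]_(p, q)) :
  (forall i, measurable_fun setT (f i)) ->
  measurable_fun setT (fun t => \sum_(i <- s) f i t).
Proof.
move=> mf; apply: measurable_fun_mx => i j; under eq_fun do rewrite summxE.
by apply: measurable_sum => k; exact: measurable_fun_mxE.
Qed.

Lemma measurable_fun_det (n : nat) (f : T -> 'M[R]_n) :
  measurable_fun setT f -> measurable_fun setT (fun t => \det (f t)).
Proof.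
move=> mf; apply: measurable_sum => s; apply: measurable_funM => //.
by apply: measurable_prod => i _; exact: measurable_fun_mxE.
Qed.

Lemma measurable_fun_invmx (n : nat) (f : T -> 'M[R]_n) :
  measurable_fun setT f -> measurable_fun setT (fun t => invmx (f t)).
Proof.
move=> mf; rewrite /invmx.
(* [invmx] returns a singular matrix unchanged, so the proof splits on whether the determinant
   vanishes; otherwise the inverse is the adjugate over the determinant. *)
apply: measurable_fun_ifT => //.
  under eq_fun do rewrite unitmxE unitfE.
  have := measurable_fun_eqr (measurable_fun_det mf) (measurable_cst (0 : R)).
  exact: measurable_neg.
apply: measurable_fun_scalemx.
  exact: measurableT_comp (@measurable_fun_inv R) (measurable_fun_det mf).
apply: measurable_fun_mx => i j; under eq_fun do rewrite mxE.
apply: measurable_funM => //; apply: measurable_fun_det.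
apply: measurable_fun_mx => k l; under eq_fun do rewrite !mxE.
exact: measurable_fun_mxE.
Qed.

End matrix_measurability.

(** * Law of the ensemble averages *)

Section enkf_law.
Context {R : realType} {d m : nat} {dO : measure_display}
  {Om : measurableType dO}.

(** No sigma-algebra is fixed here: [cylinders P n] below generates one that sees finitely many
    coordinates, those whose joint law is prescribed. *)
Definition noise_space : Type :=
  ((nat -> 'cV[R]_d) * (nat -> Om) * (nat -> nat -> 'cV[R]_m))%type.

HB.instance Definition _ := Pointed.on noise_space.

(* The coordinate projections: enkf run on them is the function of the noise
   that enkf applies to an arbitrary particle noise, see enkf_noise_at. *)
Definition canonical_noise : particle_noise R d m Om noise_space :=
  ParticleNoise (fun i c => c.1.1 i) (fun i c => c.1.2 i)
    (fun n i c => c.2 n i).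

(** The shift by [a] lets an ensemble starting at particle [a] be treated as one starting at
    particle 0. *)
Definition noise_at (T : Type) (z : particle_noise R d m Om T) (a : nat)
    (t : T) : noise_space :=
  (fun i => init z (a + i) t, fun i => drive z (a + i) t,
   fun n i => pert z n (a + i) t).

(* The finitely many noise variables that act on the first P particles up to
   time n. *)
Definition noise_keys (P n : nat) : seq (nat + nat + nat * nat) :=
  [seq inl (inl i) | i <- iota 0 P] ++ [seq inl (inr i) | i <- iota 0 P] ++
  [seq inr (k, i) | k <- iota 1 n, i <- iota 0 P].

Definition shift_key (a : nat) (k : nat + nat + nat * nat) :=
  match k with
  | inl (inl i) => inl (inl (a + i)%N)
  | inl (inr i) => inl (inr (a + i)%N)
  | inr (n, i) => inr (n, (a + i)%N)
  end.

Definition unshift_key (a : nat) (k : nat + nat + nat * nat) :=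
  match k with
  | inl (inl i) => inl (inl (i - a)%N)
  | inl (inr i) => inl (inr (i - a)%N)
  | inr (n, i) => inr (n, (i - a)%N)
  end.

Lemma shift_keyK a : cancel (shift_key a) (unshift_key a).
Proof. by case=> [[i|i]|[n i]] /=; rewrite addKn. Qed.

Lemma mem_noise_keys P n k : k \in noise_keys P n ->
  noise_used P k.
Proof.
rewrite !mem_cat => /or3P[/mapP[i]|/mapP[i]|/allpairsP[[l i] []]];
  rewrite !mem_iota /=; [by move=> iP -> ..|].
by move=> /andP[l0 _] iP -> /=; rewrite l0.
Qed.

Lemma noise_keys_uniq P n : uniq (noise_keys P n).
Proof.
rewrite /noise_keys !cat_uniq !map_inj_uniq ?iota_uniq; [|by move=> ? ? []..].
rewrite allpairs_uniq ?iota_uniq//; last by move=> [? ?] [? ?] _ _ [-> ->].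
rewrite andbT /= -!all_predC; apply/andP; split.
  apply/allP => k; rewrite mem_cat.
  by move=> /orP[/mapP[i _ ->]|/allpairsP[i [_ _ ->]]]; apply/mapP => -[].
by apply/allP => k /allpairsP[i [_ _ ->]]; apply/mapP => -[].
Qed.

Lemma shift_key_used a P c k : (a + P <= c)%N -> noise_used P k ->
  noise_used c (shift_key a k).
Proof.
move=> aP; have lt i : (i < P)%N -> (a + i < c)%N.
  by move=> iP; rewrite (leq_trans _ aP)// ltn_add2l.
by case: k => [[i|i]|[n i]] /=; [exact: lt|exact: lt|move=> /andP[-> /lt ->]].
Qed.

Definition coord_sigma (k : nat + nat + nat * nat) : set (set noise_space) :=
  match k with
  | inl (inl i) => preimage_set_system setT (init canonical_noise i) measurable
  | inl (inr i) => preimage_set_system setT (drive canonical_noise i) measurable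
  | inr (n, i) => preimage_set_system setT (pert canonical_noise n i) measurable
  end.

Definition cylinders (P n : nat) : set (set noise_space) :=
  [set B | exists2 A : nat + nat + nat * nat -> set noise_space,
     (forall k, coord_sigma k (A k)) &
     B = \bigcap_(k in [set` noise_keys P n]) A k].

Lemma coord_sigmaT k : coord_sigma k setT.
Proof.
by case: k => [[i|i]|[n i]]; exists setT; rewrite ?preimage_setT ?setTI.
Qed.

Lemma coord_sigmaI k : setI_closed (coord_sigma k).
Proof.
by case: k => [[i|i]|[n i]] _ _ [A mA <-] [B mB <-]; exists (A `&` B);
  rewrite ?preimage_setI ?setTI//; exact: measurableI.
Qed.

Lemma cylindersT P n : cylinders P n setT.
Proof.
by exists (fun=> setT) => [k|]; [exact: coord_sigmaT|rewrite bigcapT].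
Qed.

Lemma cylindersI P n : setI_closed (cylinders P n).
Proof.
move=> _ _ [A mA ->] [B mB ->]; exists (fun k => A k `&` B k).
  by move=> k; exact: coord_sigmaI.
by rewrite bigcapI.
Qed.

(** An event on one coordinate is the cylinder whose other factors are the whole space. *)
Lemma coord_measurable P n k A : k \in noise_keys P n -> coord_sigma k A ->
  @measurable _ (g_sigma_algebraType (cylinders P n)) A.
Proof.
move=> kP kA; apply: sub_sigma_algebra.
exists (fun l => if l == k then A else setT).
  by move=> l; case: eqP => [->//|_]; exact: coord_sigmaT.
apply/seteqP; split=> [c Ac l _|c /(_ k kP)]; last by rewrite eqxx.
by case: eqP.
Qed.

Lemma init_measurable P n i : (i < P)%N -> measurable_fun setT
  (init canonical_noise i : g_sigma_algebraType (cylinders P n) -> 'cV[R]_d).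
Proof.
move=> iP _ B mB.
apply: (coord_measurable (k := inl (inl i))); last by exists B.
by rewrite mem_cat (map_f (fun i => inl (inl i))) ?mem_iota.
Qed.

Lemma drive_measurable P n i : (i < P)%N -> measurable_fun setT
  (drive canonical_noise i : g_sigma_algebraType (cylinders P n) -> Om).
Proof.
move=> iP _ B mB.
apply: (coord_measurable (k := inl (inr i))); last by exists B.
by rewrite !mem_cat (map_f (fun i => inl (inr i))) ?orbT// mem_iota.
Qed.

Lemma pert_measurable P n k i : (k < n)%N -> (i < P)%N -> measurable_fun setT
  (pert canonical_noise k.+1 i :
     g_sigma_algebraType (cylinders P n) -> 'cV[R]_m).
Proof.
move=> kn iP _ B mB.
apply: (coord_measurable (k := inr (k.+1, i))); last by exists B.
rewrite !mem_cat; apply/orP; right; apply/orP; right.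
by apply/allpairsP; exists (k.+1, i); rewrite !mem_iota.
Qed.

Section noise_at.
Context {dT : measure_display} {T : measurableType dT}.
Variables (Pr : probability T R).
Variables (rho0 : set 'cV[R]_d -> \bar R) (PO : set Om -> \bar R)
  (gam : set 'cV[R]_m -> \bar R).

Lemma noise_sigma_shift (z : particle_noise R d m Om T) a k A :
  coord_sigma k A ->
  noise_sigma z (shift_key a k) (noise_at z a @^-1` A).
Proof. by case: k => [[i|i]|[n i]] [B mB <-]; exists B; rewrite ?setTI. Qed.

Lemma noise_sigma_measurable (z : particle_noise R d m Om T) c k A :
  is_particle_noise Pr z c rho0 PO gam ->
  noise_used c k -> noise_sigma z k A -> measurable A.
Proof.
move=> [h1 h2 h3 _].
case: k => [[i|i]|[n i]] /= => [ic|ic|/andP[n0 ic]] [B mB <-].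
- exact: (h1 _ ic).1.
- exact: (h2 _ ic).1.
- exact: (h3 _ _ n0 ic).1.
Qed.

Variables (z z' : particle_noise R d m Om T) (a a' c c' P n : nat).
Hypothesis zP : is_particle_noise Pr z c rho0 PO gam.
Hypothesis zP' : is_particle_noise Pr z' c' rho0 PO gam.
Hypotheses (aPc : (a + P <= c)%N) (aPc' : (a' + P <= c')%N).

Lemma noise_at_key_law k A : noise_used P k -> coord_sigma k A ->
  Pr (noise_at z a @^-1` A) = Pr (noise_at z' a' @^-1` A).
Proof.
move=> uk; have := shift_key_used aPc' uk; have := shift_key_used aPc uk.
have [h1 h2 h3 _] := zP; have [h1' h2' h3' _] := zP'.
case: k {uk} => [[i|i]|[l i]] /=
  => [ic ic'|ic ic'|/andP[l0 ic] /andP[_ ic']] [B mB <-]; rewrite setTI.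
- exact: (etrans ((h1 _ ic).2 B mB) (esym ((h1' _ ic').2 B mB))).
- exact: (etrans ((h2 _ ic).2 B mB) (esym ((h2' _ ic').2 B mB))).
- exact: (etrans ((h3 _ _ l0 ic).2 B mB) (esym ((h3' _ _ l0 ic').2 B mB))).
Qed.

End noise_at.

Section joint_law.
Context {dT : measure_display} {T : measurableType dT}.
Variables (Pr : probability T R).
Variables (rho0 : set 'cV[R]_d -> \bar R) (PO : set Om -> \bar R)
  (gam : set 'cV[R]_m -> \bar R).

(* Independence turns the probability of a cylinder into a product over the
   coordinates, so that it depends on the marginal laws only. *)
Lemma preimage_cylinder (z : particle_noise R d m Om T) a c P n
    (A : nat + nat + nat * nat -> set noise_space) :
  is_particle_noise Pr z c rho0 PO gam -> (a + P <= c)%N ->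
  (forall k, coord_sigma k (A k)) ->
  measurable (noise_at z a @^-1` \bigcap_(k in [set` noise_keys P n]) A k) /\
  Pr (noise_at z a @^-1` \bigcap_(k in [set` noise_keys P n]) A k) =
    (\prod_(k <- noise_keys P n) Pr (noise_at z a @^-1` A k))%E.
Proof.
move=> zP aPc AP; rewrite preimage_bigcap; split.
  apply: fin_bigcap_measurable => // k /mem_noise_keys/(shift_key_used aPc) kc.
  exact: noise_sigma_measurable zP kc (noise_sigma_shift z a (AP k)).
have [_ _ _ zI] := zP.
have := zI (map (shift_key a) (noise_keys P n))
  (fun k => noise_at z a @^-1` A (unshift_key a k)).
rewrite map_inj_uniq ?noise_keys_uniq; last exact/can_inj/shift_keyK.
rewrite big_map; under eq_bigr do rewrite shift_keyK; move=> <- //.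
  congr (Pr _); apply/seteqP; split=> t h k /=.
    by move=> /mapP[l lP ->]; rewrite shift_keyK; exact: h.
  move=> kP; have := h (shift_key a k).
    by rewrite /= shift_keyK; apply; rewrite map_f.
move=> _ /mapP[l lP ->]; split.
  exact/(shift_key_used aPc)/(mem_noise_keys lP).
by rewrite shift_keyK; exact: noise_sigma_shift.
Qed.

Lemma noise_at_measurable (z : particle_noise R d m Om T) a c P n :
  is_particle_noise Pr z c rho0 PO gam -> (a + P <= c)%N ->
  measurable_fun setT (noise_at z a : T -> g_sigma_algebraType (cylinders P n)).
Proof.
move=> zP aPc; apply: (measurability _ (erefl :
  @measurable _ (g_sigma_algebraType (cylinders P n)) = <<s cylinders P n >>)).
move=> _ [_ [A AP ->] <-]; rewrite setTI.
exact: (preimage_cylinder n zP aPc AP).1.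
Qed.

(** The two laws agree on the cylinders, which are stable under intersection and contain the whole
    space, hence on the generated sigma-algebra. *)
Lemma noise_at_law (z z' : particle_noise R d m Om T) a a' c c' P n B :
  is_particle_noise Pr z c rho0 PO gam ->
  is_particle_noise Pr z' c' rho0 PO gam ->
  (a + P <= c)%N -> (a' + P <= c')%N ->
  <<s cylinders P n >> B ->
  Pr (noise_at z a @^-1` B) = Pr (noise_at z' a' @^-1` B).
Proof.
move=> zP zP' aPc aPc' sB.
pose X : {mfun T >-> g_sigma_algebraType (cylinders P n)} :=
  mfun_Sub (mem_set (noise_at_measurable zP aPc)).
pose X' : {mfun T >-> g_sigma_algebraType (cylinders P n)} :=
  mfun_Sub (mem_set (noise_at_measurable zP' aPc')).
have := @g_sigma_algebra_measure_unique _ R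
  (g_sigma_algebraType (cylinders P n)) (cylinders P n) _ (fun=> setT) _ _
  (distribution Pr X) (distribution Pr X') _ _ _ B sB.
apply => //.
- exact: sub_sigma_algebra.
- by move=> _; exact: cylindersT.
- by rewrite bigcup_const.
- exact: cylindersI.
- move=> _ [A AP ->].
  rewrite /= /distribution /pushforward /=.
  transitivity (\prod_(k <- noise_keys P n) Pr (noise_at z a @^-1` A k))%E.
    exact: (preimage_cylinder n zP aPc AP).2.
  transitivity (\prod_(k <- noise_keys P n) Pr (noise_at z' a' @^-1` A k))%E.
    apply: eq_big_seq => k /mem_noise_keys kP.
    exact: (noise_at_key_law zP zP' aPc aPc' kP (AP k)).
  exact/esym/(preimage_cylinder n zP' aPc' AP).2.
- move=> _; apply: le_lt_trans (ltry 1).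
  exact: (@probability_le1 _ _ _ (distribution Pr X)).
Qed.

End joint_law.

End enkf_law.

(** * The EnKF recursion as a measurable function of the noise *)

Section enkf_law.
Context {R : realType} {d m : nat} {dO : measure_display}
  {Om : measurableType dO}.
Section enkf_measurability.
Variables (H : 'M[R]_(m, d)) (Gam : 'M[R]_m) (y : nat -> 'cV[R]_m).
Variable PsiN : nat -> nat -> 'cV[R]_d -> Om -> 'cV[R]_d.

Lemma sum_nat_shift (V : nmodType) a P (F : nat -> V) :
  \sum_(a <= i < a + P) F i = \sum_(0 <= i < P) F (a + i)%N.
Proof.
rewrite -[X in \sum_(X <= _ < _) _]add0n big_addn addKn.
by apply: eq_bigr => i _; rewrite addnC.
Qed.

Lemma ens_covDl a P (v : nat -> 'cV[R]_d) :
  ens_cov a P v = ens_cov 0 P (fun i => v (a + i)%N).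
Proof.
by rewrite /ens_cov /ens_mean (sum_nat_shift a P v) (sum_nat_shift a).
Qed.

(** Particle numbers enter the recursion only through the noise and the range of the sample
    covariance, so renumbering by [a] commutes with it. *)
Lemma enkf_noise_at (T : Type) (z : particle_noise R d m Om T) N a P n i t :
  enkf H Gam y PsiN z N a P n (a + i) t =
  enkf H Gam y PsiN canonical_noise N 0 P n i (noise_at z a t).
Proof.
elim: n i => [//|n IH] i.
pose v j := PsiN n N (enkf H Gam y PsiN z N a P n j t) (drive z j t).
pose v' j := PsiN n N
  (enkf H Gam y PsiN canonical_noise N 0 P n j (noise_at z a t))
  (drive canonical_noise j (noise_at z a t)).
have vE j : v (a + j)%N = v' j by rewrite /v IH.
have covE : ens_cov a P v = ens_cov 0 P v' by rewrite ens_covDl (funext vE).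
exact: (congr2 (fun C w => update H (gain H Gam C) w _) covE (vE i)).
Qed.

Lemma measurable_fun_gain (dT : measure_display) (T : measurableType dT)
    (C : T -> 'M[R]_d) : measurable_fun setT C ->
  measurable_fun setT (fun t => gain H Gam (C t)).
Proof.
move=> mC; rewrite /gain; apply: measurable_fun_mulmx.
  exact: measurable_fun_mulmx.
apply: measurable_fun_invmx; apply: measurable_fun_addmx => //.
by apply: measurable_fun_mulmx => //; exact: measurable_fun_mulmx.
Qed.

Lemma measurable_fun_update (dT : measure_display) (T : measurableType dT)
    (K : T -> 'M[R]_(d, m)) (v : T -> 'cV[R]_d) (w : T -> 'cV[R]_m) :
  measurable_fun setT K -> measurable_fun setT v -> measurable_fun setT w ->
  measurable_fun setT (fun t => update H (K t) (v t) (w t)).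
Proof.
move=> mK mv mw; apply: measurable_fun_addmx; apply: measurable_fun_mulmx => //.
apply: measurable_fun_addmx => //; apply: measurable_fun_oppmx.
exact: measurable_fun_mulmx.
Qed.

Lemma measurable_fun_ens_mean (dT : measure_display) (T : measurableType dT)
    P (v : nat -> T -> 'cV[R]_d) :
  (forall i, (i < P)%N -> measurable_fun setT (v i)) ->
  measurable_fun setT (fun t => ens_mean 0 P (fun i => v i t)).
Proof.
move=> mv; apply: measurable_fun_scalemx => //.
under eq_fun do rewrite big_mkord; apply: measurable_fun_summx => i.
exact: mv.
Qed.

Lemma measurable_fun_ens_cov (dT : measure_display) (T : measurableType dT)
    P (v : nat -> T -> 'cV[R]_d) :
  (forall i, (i < P)%N -> measurable_fun setT (v i)) ->
  measurable_fun setT (fun t => ens_cov 0 P (fun i => v i t)).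
Proof.
move=> mv; have mm := measurable_fun_ens_mean mv.
apply: measurable_fun_addmx; last first.
  apply: measurable_fun_oppmx; apply: measurable_fun_mulmx => //.
  exact: measurable_fun_trmx.
apply: measurable_fun_scalemx => //.
under eq_fun do rewrite big_mkord; apply: measurable_fun_summx => i.
by apply: measurable_fun_mulmx; [|apply: measurable_fun_trmx]; exact: mv.
Qed.

Hypothesis mPsiN : forall n k, (0 < k)%N -> measurable_fun setT
  (fun x : 'cV[R]_d * Om => PsiN n k x.1 x.2).

(** The horizon [n'] is separate from the time [n] so that the sigma-algebra stays fixed during the
    induction on [n]. *)
Lemma enkf_measurable N P n' n i : (0 < N)%N -> (n <= n')%N -> (i < P)%N ->
  measurable_fun setT
    (enkf H Gam y PsiN canonical_noise N 0 P n i :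
       g_sigma_algebraType (@cylinders R d m _ Om P n') -> 'cV[R]_d).
Proof.
move=> N0; elim: n i => [|n IH] i nn' iP /=.
  exact: init_measurable.
have mv j : (j < P)%N -> measurable_fun setT (fun t :
    g_sigma_algebraType (@cylinders R d m _ Om P n') => PsiN n N
    (enkf H Gam y PsiN canonical_noise N 0 P n j t)
    (drive canonical_noise j t)).
  move=> jP; have mp := measurable_fun_pair (IH j (ltnW nn') jP)
    (drive_measurable jP).
  exact: (measurableT_comp (mPsiN n N0) mp).
apply: measurable_fun_update.
- exact/measurable_fun_gain/measurable_fun_ens_cov.
- exact: mv.
- by apply: measurable_fun_addmx => //; exact: pert_measurable.
Qed.

Lemma measurable_ens_average (phi : 'cV[R]_d -> R) N P n :
  measurable_fun setT phi -> (0 < N)%N ->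
  measurable_fun setT (ens_average H Gam y PsiN canonical_noise N 0 P n phi :
    g_sigma_algebraType (@cylinders R d m _ Om P n) -> R).
Proof.
move=> mphi N0; apply: measurable_funM => //.
under eq_fun do rewrite big_mkord; apply: measurable_sum => i.
have := @enkf_measurable N P n n i N0 (leqnn n) (ltn_ord i).
exact: measurableT_comp.
Qed.

Lemma ens_average_noise_at (T : Type) (z : particle_noise R d m Om T)
    phi N a P n :
  ens_average H Gam y PsiN z N a P n phi =
  ens_average H Gam y PsiN canonical_noise N 0 P n phi \o noise_at z a.
Proof.
apply/funext => t; rewrite /ens_average sum_nat_shift; congr (_ * _).
by apply: eq_bigr => i _; rewrite enkf_noise_at.
Qed.

Section law.
Context {dT : measure_display} {T : measurableType dT}.
Variables (Pr : probability T R).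
Variables (rho0 : set 'cV[R]_d -> \bar R) (PO : set Om -> \bar R)
  (gam : set 'cV[R]_m -> \bar R).

(** Different noises and offsets are allowed, so as to compare a sub-ensemble inside a coupled
    family with the separate EnKF estimator of the same size. *)
Lemma ens_average_law (z z' : particle_noise R d m Om T) phi N a a' c c' P n :
  is_particle_noise Pr z c rho0 PO gam ->
  is_particle_noise Pr z' c' rho0 PO gam ->
  (a + P <= c)%N -> (a' + P <= c')%N -> measurable_fun setT phi -> (0 < N)%N ->
  has_law Pr (ens_average H Gam y PsiN z N a P n phi)
    (pushforward Pr (ens_average H Gam y PsiN z' N a' P n phi)).
Proof.
move=> zP zP' aPc aPc' mphi N0.
rewrite (ens_average_noise_at z) (ens_average_noise_at z').
have mE := measurable_ens_average (P := P) (n := n) mphi N0.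
split; first exact: (measurableT_comp mE (noise_at_measurable zP aPc)).
move=> B mB; have := mE measurableT B mB; rewrite setTI => mEB.
exact: (noise_at_law zP zP' aPc aPc' mEB).
Qed.

End law.

End enkf_measurability.

End enkf_law.

(** For k >= L the value g(k, k) is the sum over a box containing the triangle, and the bound on the
    part off the triangle is uniform in k; hence it survives the limit. *)
Lemma triangle_bias_le (R : realType) (g : nat * nat -> R) (c C : R) L :
  (fun k => g (k, k)) @ \oo --> c -> 0 <= C ->
  (forall l, `|mixed_difference g l| <= C * 2^-1 ^+ (l.1 + l.2)) ->
  `|\sum_(l <- triangle L) mixed_difference g l - c| <=
    C * ((L + 3)%:R * 2^-1 ^+ L).
Proof.
move=> gc C0 gC; set S := \sum_(l <- _) _.
have cS : (fun k => `|S - g (k, k)|) @ \oo --> `|S - c|.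
  by apply: cvg_norm; apply: cvgB => //; exact: cvg_cst.
apply: (cvgr_to_le cS); near=> k.
rewrite distrC -sum_mixed_difference; apply: sum_off_triangle_le => //.
by near: k; exact: nbhs_infty_ge.
Unshelve. all: by end_near. Qed.

(** * Moments of the coupled estimator *)

Section half_sum.
Context {R : realType} {d : measure_display} {T : measurableType d}.
Variable P : probability T R.

Lemma half_sum_moments (X Y : T -> R) (e : R) :
  X \in Lfun P 2%:E -> Y \in Lfun P 2%:E ->
  'E_P[X]%E = e%:E -> 'E_P[Y]%E = e%:E ->
  (2^-1 \o* (X \+ Y)) \in Lfun P 2%:E /\ 'E_P[(2^-1 \o* (X \+ Y))%R]%E = e%:E.
Proof.
move=> X2 Y2 EX EY.
have XY2 : X \+ Y \in Lfun P 2%:E by rewrite rpredD ?lee1n.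
split; first by apply: Lfun_scale; rewrite ?ler1n.
rewrite expectationZl ?Lfun2_Lfun1// expectationD ?Lfun2_Lfun1// EX EY.
by rewrite -EFinD -EFinM; congr (_%:E); field.
Qed.

End half_sum.

Section coupled_moments.
Context {R : realType} {d m : nat} {dO : measure_display}
  {Om : measurableType dO} {dT : measure_display} {T : measurableType dT}.
Variables (H : 'M[R]_(m, d)) (Gam : 'M[R]_m) (y : nat -> 'cV[R]_m).
Variable PsiN : nat -> nat -> 'cV[R]_d -> Om -> 'cV[R]_d.
Variables (N0 P0 : nat) (Pr : probability T R).
Variable z : nat * nat -> particle_noise R d m Om T.
Variables (rho0 : set 'cV[R]_d -> \bar R) (PO : set Om -> \bar R)
  (gam : set 'cV[R]_m -> \bar R).
Variables (phi : 'cV[R]_d -> R) (n : nat).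
Hypothesis N0_gt0 : (0 < N0)%N.
Hypothesis mPsiN : forall n k, (0 < k)%N -> measurable_fun setT
  (fun x : 'cV[R]_d * Om => PsiN n k x.1 x.2).
Hypothesis zP : forall l, is_particle_noise Pr (z l) (Pl P0 l.2) rho0 PO gam.
Hypothesis mphi : measurable_fun setT phi.

Let mu l := enkf_est H Gam y PsiN N0 P0 z n l phi.
Let avg l := fun N a P => ens_average H Gam y PsiN (z l) N a P n phi.

Hypothesis mu2 : forall l, mu l \in Lfun Pr 2%:E.

Let g l : R := fine 'E_Pr[mu l]%E.

Let muE l : 'E_Pr[mu l]%E = (g l)%:E.
Proof. by rewrite fineK// expectation_fin_num// Lfun2_Lfun1. Qed.

(** The sub-ensemble runs on the noise of index [l], but has the law of the estimator at index
    [(a, b)], whose moments are known. *)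
Lemma ens_average_moments l a b off : (off + Pl P0 b <= Pl P0 l.2)%N ->
  avg l (Nl N0 a) off (Pl P0 b) \in Lfun Pr 2%:E /\
  'E_Pr[avg l (Nl N0 a) off (Pl P0 b)]%E = (g (a, b))%:E.
Proof.
move=> offP.
have Na : (0 < Nl N0 a)%N by rewrite muln_gt0 N0_gt0 expn_gt0.
have law : has_law Pr (avg l (Nl N0 a) off (Pl P0 b))
    (pushforward Pr (mu (a, b))).
  have le0 : (0 + Pl P0 b <= Pl P0 (a, b).2)%N by [].
  have := ens_average_law H Gam y mPsiN n (zP l) (zP (a, b)) offP le0 mphi Na.
  exact.
have mm := Lfun_measurable (mu2 (a, b)).
split; first exact: (has_law_Lfun2 mm law).
by rewrite (has_law_expectation mm law) ?muE// Lfun2_Lfun1.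
Qed.

Let PlS b : Pl P0 b.+1 = (Pl P0 b + Pl P0 b)%N.
Proof. by rewrite /Pl expnS; lia. Qed.

Lemma coupled_est_moments l :
  coupled_est H Gam y PsiN N0 P0 z n l phi \in Lfun Pr 2%:E /\
  'E_Pr[coupled_est H Gam y PsiN N0 P0 z n l phi]%E = (mixed_difference g l)%:E.
Proof.
case: l => l1 l2.
pose F0 := avg (l1, l2) (Nl N0 l1) 0%N (Pl P0 l2).
pose halves N k := 2^-1 \o* (avg (l1, l2) N 0%N (Pl P0 k) \+
  avg (l1, l2) N (Pl P0 k) (Pl P0 k)).
pose F2 := if l2 is k2.+1 then halves (Nl N0 l1) k2 else cst 0.
pose F1 :=
  if l1 is k1.+1 then avg (l1, l2) (Nl N0 k1) 0%N (Pl P0 l2) else cst 0.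
pose F12 := if l1 is k1.+1 then
  if l2 is k2.+1 then halves (Nl N0 k1) k2 else cst 0 else cst 0.
have -> : coupled_est H Gam y PsiN N0 P0 z n (l1, l2) phi =
    ((F0 \- F2) \- F1) \+ F12.
  apply/funext => t; rewrite /coupled_est /F0 /F2 /F1 /F12 /halves /avg.
  by case: (l1) => [|k1]; case: (l2) => [|k2] //=; rewrite ![_ * 2^-1]mulrC.
have zero : (cst 0 : T -> R) \in Lfun Pr 2%:E /\ 'E_Pr[cst (0%R : R)]%E = 0%:E.
  by split; [exact: Lfun_cst|rewrite expectation_cst].
(* The two half ensembles, at offsets 0 and P_k, fit in the P_(k+1) = 2 P_k particles of the
   index. *)
have halvesP a k : l2 = k.+1 -> halves (Nl N0 a) k \in Lfun Pr 2%:E /\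
    'E_Pr[halves (Nl N0 a) k]%E = (g (a, k))%:E.
  move=> l2E.
  have [|X2 EX] := @ens_average_moments (l1, l2) a k 0%N.
    by rewrite /= l2E PlS leq_addr.
  have [|Y2 EY] := @ens_average_moments (l1, l2) a k (Pl P0 k).
    by rewrite /= l2E PlS.
  exact: half_sum_moments.
have [X0 E0] : F0 \in Lfun Pr 2%:E /\ 'E_Pr[F0]%E = (g (l1, l2))%:E.
  exact: ens_average_moments.
have [X2 E2] : F2 \in Lfun Pr 2%:E /\
    'E_Pr[F2]%E = (if l2 is k.+1 then g (l1, k) else 0)%:E.
  by rewrite /F2; case: (l2) halvesP => [//|k] /(_ l1 k erefl).
have [X1 E1] : F1 \in Lfun Pr 2%:E /\
    'E_Pr[F1]%E = (if l1 is k.+1 then g (k, l2) else 0)%:E.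
  by rewrite /F1; case: (l1) => [//|k]; exact: ens_average_moments.
have [X12 E12] : F12 \in Lfun Pr 2%:E /\ 'E_Pr[F12]%E =
    (if l1 is k1.+1 then if l2 is k2.+1 then g (k1, k2) else 0 else 0)%:E.
  rewrite /F12; case: (l1) => [//|k1]; case: (l2) halvesP => [//|k2].
  by move=> /(_ k1 k2 erefl).
have Xa : F0 \- F2 \in Lfun Pr 2%:E by rewrite rpredB ?lee1n.
have Xb : F0 \- F2 \- F1 \in Lfun Pr 2%:E by rewrite rpredB ?lee1n.
split; first by rewrite rpredD ?lee1n.
rewrite expectationD ?Lfun2_Lfun1// expectationB ?Lfun2_Lfun1//.
by rewrite expectationB ?Lfun2_Lfun1// E0 E1 E2 E12.
Qed.

End coupled_moments.

(** * Assembly of the error and cost bounds *)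

Theorem theorem1 (R : realType) (d m : nat)
    (* filtered probability space, filtering model, numerical maps *)
    (dO : measure_display) (Om : measurableType dO) (P : probability Om R)
    (F : R -> set (set Om)) (u0 : Om -> 'cV[R]_d)
    (Psi : nat -> 'cV[R]_d -> Om -> 'cV[R]_d)
    (PsiN : nat -> nat -> 'cV[R]_d -> Om -> 'cV[R]_d)
    (H : 'M[R]_(m, d)) (Gam : 'M[R]_m) (gam : probability 'cV[R]_m R)
    (y : nat -> 'cV[R]_m) (N0 P0 : nat)
    (* simulation space with the noise of the mean-field particle and of the
       coupled ensembles *)
    (dT : measure_display) (T : measurableType dT) (Pr : probability T R)
    (zbar : particle_noise R d m Om T)
    (z : nat * nat -> particle_noise R d m Om T)
    (mubar : nat -> probability 'cV[R]_d R)
    (cost : ('cV[R]_d -> R) -> nat -> nat * nat -> R)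
    (* multi-index method *)
    (L0 : nat) (M : R -> nat * nat -> nat)
    (dS : measure_display) (S : measurableType dS) (Q : probability S R) :
  let N l1 := Nl N0 l1 in
  let Pn l2 := Pl P0 l2 in
  let mu n l phi := enkf_est H Gam y PsiN N0 P0 z n l phi in
  let Delta n l phi := coupled_est H Gam y PsiN N0 P0 z n l phi in
  let is_admissible := admissible mubar Pr mu in
  let I eps := triangle (level L0 eps) in
  let eps_range := [set eps : R | 0 < eps < 1] in
  (0 < N0)%N -> (0 < P0)%N ->
  (* standing assumptions of the filtering model *)
  complete_filtration P F ->
  Lspace_all P (F 0) u0 ->
  (forall n, measurable_fun setT
     (fun x : 'cV[R]_d * Om => Psi n x.1 x.2)) ->
  (forall n k, (0 < k)%N -> measurable_fun setT
     (fun x : 'cV[R]_d * Om => PsiN n k x.1 x.2)) ->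
  spd Gam -> is_centered_gaussian Gam gam ->
  (* mean-field EnKF measures *)
  is_particle_noise Pr zbar 1 (pushforward P u0) P gam ->
  (forall n, has_law Pr (mean_field H Gam y Psi Pr zbar n) (mubar n)) ->
  (* noise of the coupled ensembles *)
  (forall l, is_particle_noise Pr (z l) (Pn l.2) (pushforward P u0) P gam) ->
  (* mubar n is the large-ensemble and fine-discretization limit of EnKF *)
  (forall phi n, is_admissible phi ->
     (fun l : nat * nat => 'E_Pr[mu n l phi]%E) @ filter_prod \oo \oo
       --> (\int[mubar n]_x (phi x)%:E)%E) ->
  (forall phi n l, 0 < cost phi n l) ->
  (* assumption (1) *)
  (forall n (p : R), 2 <= p -> exists2 c : R, 0 < c &
     forall u v : Om -> 'cV[R]_d,
       Lspace_all P (F n%:R) u -> Lspace_all P (F n%:R) v ->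
     forall k, (1 <= k)%N ->
       (rv_norm P p (fun w => PsiN n k (u w) w)
          <= c%:E * (1 + rv_norm P p u))%E /\
       (rv_norm P p (fun w => (PsiN n k (u w) w - PsiN n k (v w) w)%R)
          <= c%:E * rv_norm P p (fun w => (u w - v w)%R))%E) ->
  (* assumption (2) *)
  (forall phi n, is_admissible phi ->
     [/\ lesssim setT (fun l => `|'E_Pr[Delta n l phi]|%E)
           (fun l => ((N l.1)%:R^-1 * (Pn l.2)%:R^-1)%:E),
         lesssim setT (fun l => 'V_Pr[Delta n l phi]%E)
           (fun l => ((N l.1)%:R ^- 2 * (Pn l.2)%:R ^- 2)%:E) &
         eqsim setT (fun l => (cost phi n l)%:E)
           (fun l => ((N l.1)%:R * (Pn l.2)%:R)%:E)]) ->
  (* numbers of samples *)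
  (forall eps l, eps_range eps -> l \in I eps -> (0 < M eps l)%N) ->
  eqsim [set x : R * (nat * nat) | eps_range x.1 /\ x.2 \in I x.1]
    (fun x => (M x.1 x.2)%:R%:E)
    (fun x => (x.1 ^- 2 * (N x.2.1)%:R `^ (- (3 / 2))
                 * (Pn x.2.2)%:R `^ (- (3 / 2)))%:E) ->
  forall (phi : 'cV[R]_d -> R) (n : nat), is_admissible phi ->
    (forall X : R -> nat * nat -> nat -> S -> R,
       (forall eps, eps_range eps ->
          independent_copies Q Pr (I eps) (M eps)
            (fun l => Delta n l phi) (X eps)) ->
       lesssim eps_range
         (fun eps => 'E_Q[(fun s =>
            (mi_est (I eps) (M eps) (X eps) s
               - \int[mubar n]_x phi x) ^+ 2)%R]%E)
         (fun eps => (eps ^+ 2)%:E)) /\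
    eqsim eps_range
      (fun eps => (mi_cost (I eps) (M eps) (cost phi n))%:E)
      (fun eps => (eps ^- 2)%:E).
Proof.
move=> N Pn mu Delta is_admissible I eps_range N0_gt0 P0_gt0 _ _ _ mPsiN.
move=> _ _ _ _ zP limP cost_gt0 _ ass2 M_gt0 M_eqsim phi n adm.
have [mphi /(_ n)[iphi mu2]] := adm.
pose g l : R := fine 'E_Pr[mu n l phi]%E.
pose e := mixed_difference g.
have moments l : Delta n l phi \in Lfun Pr 2%:E /\
    'E_Pr[Delta n l phi]%E = (e l)%:E.
  by have := coupled_est_moments N0_gt0 mPsiN zP mphi mu2 l.
have Delta2 l := (moments l).1.
have [[C1 C1_gt0 bias] [C2 C2_gt0 var]
  [[C4 C4_gt0 costU] [C5 C5_gt0 costL]]] := ass2 phi n adm.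
have [[C6 C6_gt0 MU] [C7 C7_gt0 ML]] := M_eqsim.
set c := \int[mubar n]_x phi x.
have cE : (\int[mubar n]_x (phi x)%:E)%E = c%:E.
  by rewrite /c /Rintegral fineK// integrable_fin_num.
have N_gt0 k : 0 < (N k)%:R :> R by rewrite ltr0n muln_gt0 N0_gt0 expn_gt0.
have P_gt0 k : 0 < (Pn k)%:R :> R by rewrite ltr0n muln_gt0 P0_gt0 expn_gt0.
(* [w] is the factor (N P)^(-3/2) of the sample numbers; [q] is the summable (N P)^(-1/2) left in
   both the variance and the cost. *)
pose q l : R := (N l.1)%:R `^ (- (1 / 2)) * (Pn l.2)%:R `^ (- (1 / 2)).
pose w l : R := (N l.1)%:R `^ (- (3 / 2)) * (Pn l.2)%:R `^ (- (3 / 2)).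
have q_gt0 l : 0 < q l by rewrite mulr_gt0// powR_gt0.
have w_gt0 l : 0 < w l by rewrite mulr_gt0// powR_gt0.
have [G G_gt0 sum_q] : exists2 G : R, 0 < G &
    forall L, \sum_(l <- triangle L) q l <= G.
  have x01 := half_root_itv (R := R).
  exists ((1 - half_root)^-1 ^+ 2).
    by rewrite exprn_gt0// invr_gt0 subr_gt0; case/andP: x01.
  move=> L; apply: le_trans (sum_triangle_le L x01).
  apply: ler_sum => l _.
  by rewrite exprD ler_pM ?powR_ge0// powR_half_scale.
have costE l : w l * ((N l.1)%:R * (Pn l.2)%:R) = q l.
  by rewrite mulrACA !powR_cost.
have varE l : (N l.1)%:R ^- 2 * (Pn l.2)%:R ^- 2 = q l * w l.
  by rewrite (powR_var (N_gt0 _)) (powR_var (P_gt0 _)) mulrACA.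
have MUr eps l : 0 < eps < 1 -> l \in I eps ->
    (M eps l)%:R <= C6 * (eps ^- 2 * w l).
  move=> he hl; have := MU (eps, l) (conj he hl).
  by rewrite -EFinM lee_fin /= -mulrA.
have MLr eps l : 0 < eps < 1 -> l \in I eps ->
    eps ^- 2 * w l <= C7 * (M eps l)%:R.
  move=> he hl; have := ML (eps, l) (conj he hl).
  by rewrite -EFinM lee_fin /= -mulrA.
have costUr l : cost phi n l <= C4 * ((N l.1)%:R * (Pn l.2)%:R).
  by have := costU l Logic.I; rewrite -EFinM lee_fin.
have costLr l : (N l.1)%:R * (Pn l.2)%:R <= C5 * cost phi n l.
  by have := costL l Logic.I; rewrite -EFinM lee_fin.
have varr l : fine 'V_Pr[Delta n l phi]%E <= C2 * (q l * w l).
  have := var l Logic.I; rewrite -EFinM varE -lee_fin fineK//.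
  exact: variance_fin_num.
(* [N0] and [P0] are at least 1, so N and P are bounded below by the bare powers of 2. *)
have biasr l : `|e l| <= C1 * 2^-1 ^+ (l.1 + l.2).
  have := bias l Logic.I; rewrite (moments l).2 -EFinM lee_fin.
  move=> /le_trans; apply.
  rewrite ler_wpM2l ?(ltW C1_gt0)// exprD !exprVn.
  apply: ler_pM; rewrite ?invr_ge0 ?(ltW (N_gt0 _)) ?(ltW (P_gt0 _))//.
    by rewrite lef_pV2 ?posrE ?exprn_gt0// -natrX ler_nat leq_pmull.
  by rewrite lef_pV2 ?posrE ?exprn_gt0// -natrX ler_nat leq_pmull.
(* The two-index limit of the EnKF means is restricted to the diagonal, where the boxes have their
   corners. *)
have gc : (fun k => g (k, k)) @ \oo --> c.
  have lim := limP phi n adm; rewrite cE in lim.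
  have diag : (fun k : nat => (k, k)) @ \oo --> filter_prod \oo \oo.
    exact: (cvg_pair cvg_id cvg_id).
  by have /fine_cvgP[_] := cvg_comp _ _ diag lim.
split.
  (* The first summand bounds the variance, the second the squared bias through [level_le]. *)
  move=> X XP; exists (C2 * C7 * G + (C1 * (7 * 2 ^+ L0)) ^+ 2).
    by rewrite ltr_wpDr ?sqr_ge0// !mulr_gt0.
  move=> eps he; have Xcop := XP eps he.
  have eps_gt0 : 0 < eps by case/andP: he.
  have uI := triangle_uniq (level L0 eps).
  have M0 l : l \in I eps -> (0 < M eps l)%N by exact: M_gt0.
  have D2 l : l \in I eps -> Delta n l phi \in Lfun Pr 2%:E by move=> _.
  rewrite mean_square_error; last exact: (mi_est_Lfun2 D2 Xcop).
  rewrite (expectation_mi_est M0 D2 Xcop) (variance_mi_est uI M0 D2 Xcop).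
  under [X in ((X - _) ^+ 2)%E]eq_bigr do rewrite (moments _).2.
  rewrite (eq_bigr (fun l =>
      ((M eps l)%:R^-1 * fine 'V_Pr[Delta n l phi]%E)%:E));
    last by move=> l _; rewrite EFinM fineK// variance_fin_num.
  rewrite !sumEFin -EFinB -EFin_expe -EFinD -EFinM lee_fin mulrDl.
  apply: lerD.
    (* The variance is at most C2 q w, and the lower bound on M_l gives w <= C7 M_l eps^2, so M_l
       cancels. *)
    apply: (@le_trans _ _ (\sum_(l <- I eps) C2 * C7 * eps ^+ 2 * q l)).
      rewrite big_seq [leRHS]big_seq; apply: ler_sum => l lI.
      rewrite mulrC ler_pdivrMr ?ltr0n ?M0//.
      apply: (le_trans (varr l)).
      have := MLr _ _ he lI; rewrite mulrC ler_pdivrMr ?exprn_gt0// => wM.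
      have := ler_wpM2l (ltW (mulr_gt0 C2_gt0 (q_gt0 l))) wM.
      rewrite mulrA => /le_trans; apply.
      by rewrite le_eqVlt; apply/orP; left; apply/eqP; ring.
    rewrite -mulr_sumr [leRHS]mulrAC.
    by rewrite ler_wpM2l// ?sum_q// ltW// !mulr_gt0// exprn_gt0.
  rewrite -exprMn -real_normK ?num_real//.
  rewrite ler_pXn2r ?nnegrE//; last by rewrite !mulr_ge0// ?exprn_ge0// ltW.
  apply: (le_trans (triangle_bias_le _ gc (ltW C1_gt0) biasr)).
  by rewrite -mulrA ler_wpM2l ?(ltW C1_gt0)// level_le.
split.
  exists (C6 * C4 * G); first by rewrite !mulr_gt0.
  move=> eps he; rewrite -EFinM lee_fin.
  have eps_gt0 : 0 < eps by case/andP: he.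
  apply: (@le_trans _ _ (\sum_(l <- I eps) C6 * C4 * eps ^- 2 * q l)).
    rewrite /mi_cost big_seq [leRHS]big_seq; apply: ler_sum => l lI.
    apply: (@le_trans _ _ ((C6 * (eps ^- 2 * w l)) *
        (C4 * ((N l.1)%:R * (Pn l.2)%:R)))).
      by apply: ler_pM => //; [exact: ltW|exact: MUr].
    by rewrite -costE le_eqVlt; apply/orP; left; apply/eqP; ring.
  rewrite -mulr_sumr [leRHS]mulrAC ler_wpM2l ?sum_q//.
  by rewrite !mulr_ge0 ?invr_ge0 ?exprn_ge0// ltW.
(* For the lower bound on the cost the single index (0, 0) suffices: it lies in every triangle and
   its term is already of order eps^-2. Dividing by q(0, 0) normalises its factor w N P. *)
exists (C7 * C5 / q (0, 0)%N); first by rewrite !mulr_gt0// invr_gt0.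
move=> eps he; rewrite -EFinM lee_fin.
have eps_gt0 : 0 < eps by case/andP: he.
have I00 : (0, 0)%N \in I eps by rewrite mem_triangle.
apply: (@le_trans _ _ (C7 * C5 / q (0, 0)%N *
    ((M eps (0, 0)%N)%:R * cost phi n (0, 0)%N))); last first.
  rewrite ler_wpM2l//; first by rewrite !mulr_ge0 ?invr_ge0// ltW.
  rewrite /mi_cost (bigD1_seq (0, 0)%N) ?triangle_uniq//= lerDl.
  by apply: sumr_ge0 => l _; rewrite mulr_ge0// ltW.
rewrite mulrAC ler_pdivlMr// -costE (mulrA (eps ^- 2)).
rewrite (_ : C7 * C5 * _ =
  (C7 * (M eps (0, 0)%N)%:R) * (C5 * cost phi n (0, 0)%N)); last by ring.
apply: ler_pM; [| |exact: MLr|exact: costLr].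
  by rewrite mulr_ge0 ?(ltW (w_gt0 _))// invr_ge0 exprn_ge0 ?ltW.
by rewrite mulr_ge0// ltW.
Qed.
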